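(* Let $\mu$ be a balanced measure on $\mathbb{R}$. There exist $\eta\in(0,1)$ and $C>0$, depending only on $\mu$, such that the following holds. Let $s,t$ be nonnegative integers with $s+t\le 1$ and let $T$ be a Haar shift of complexity $(s,t)$. Then for each pair of compactly supported, bounded, nonnegative functions $f_1,f_2$ there exists an $\eta$-sparse collection $\mathcal{S}\subset\mathscr{D}$ such that $$|\langle Tf_1,f_2\rangle|\le C\big(\mathcal{A}_{\mathcal{S}}(f_1,f_2)+\mathcal{C}_{\mathcal{S}}(f_1,f_2)\big),$$ where $$\mathcal{A}_{\mathcal{S}}(f_1,f_2)=\sum_{I\in\mathcal{S}}\langle f_1\rangle_I\langle f_2\rangle_I\,\mu(I),\qquad \mathcal{C}_{\mathcal{S}}(f_1,f_2)=\sum_{I\in\mathcal{S}}\ \sum_{J\in\mathcal{S}\cap\mathscr{D}_{\le 2}(\widehat{I})}\big[\langle f_1\rangle_I\langle f_2\rangle_J+\langle f_2\rangle_I\langle f_1\rangle_J\big]\,m(I).$$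
   Context: $\mathscr{D}$ is the standard dyadic system of half-open intervals $2^{-k}[j,j+1)$, $j,k\in\mathbb{Z}$. For $I\in\mathscr{D}$, $I_-$ and $I_+$ are its left and right dyadic children, $\widehat{I}$ its dyadic parent, and $I^{(j)}$ its $j$-th dyadic ancestor (the dyadic interval containing $I$ of length $2^j\ell(I)$). Put $\mathscr{D}_j(I)=\{J\in\mathscr{D}:J^{(j)}=I\}$ and $\mathscr{D}_{\le j}(I)=\bigcup_{k=0}^{j}\mathscr{D}_k(I)$. $\mu$ is a Borel measure on $\mathbb{R}$ with $0<\mu(I)<\infty$ for all $I\in\mathscr{D}$. Pairings and averages are with respect to $\mu$: $\langle f,g\rangle=\int fg\,d\mu$, $\langle f\rangle_I=\mu(I)^{-1}\int_I f\,d\mu$. Set $m(I)=\mu(I_-)\mu(I_+)/\mu(I)$. The measure $\mu$ is called balanced if it has no atoms and there is a constant $c\ge1$ with $c^{-1}m(\widehat{I})\le m(I)\le c\,m(\widehat{I})$ for all $I\in\mathscr{D}$. The Haar function of $I\in\mathscr{D}$ is $h_I=\sqrt{m(I)}\left(\frac{1_{I_-}}{\mu(I_-)}-\frac{1_{I_+}}{\mu(I_+)}\right)$. A Haar shift of complexity $(s,t)$ is an operator, defined on $L^2(\mu)$, of the form $Tf=\sum_{I\in\mathscr{D}}\sum_{J\in\mathscr{D}_s(I)}\sum_{K\in\mathscr{D}_t(I)}\alpha^I_{J,K}\langle f,h_J\rangle h_K$ with coefficients satisfying $\sup|\alpha^I_{J,K}|\le1$. A collection $\mathcal{S}\subset\mathscr{D}$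 is $\eta$-sparse ($0<\eta<1$) if for each $I\in\mathcal{S}$ there is a measurable $E_I\subset I$ with $\mu(E_I)\ge\eta\mu(I)$ and the sets $\{E_I\}_{I\in\mathcal{S}}$ are pairwise disjoint. *)

(* Defs.v *)
From HB Require Import structures.
From mathcomp Require Import all_boot all_order all_algebra finmap.
From mathcomp Require Import all_classical all_reals all_analysis.

Set Implicit Arguments.
Unset Strict Implicit.
Unset Printing Implicit Defensive.

Import Order.TTheory GRing.Theory Num.Theory.
Import numFieldNormedType.Exports.

Local Open Scope classical_set_scope.
Local Open Scope ring_scope.

(* The pair (k, j) stands for the interval 2^-k [j, j+1); by [ditv_inj] below
   this coding of the dyadic system by int * int is one-to-one. *)
Notation dyadic := (int * int)%type.

Definition ditv (R : realType) (I : dyadic) : set (measurableTypeR R) :=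
  `[2 ^ (- I.1) * I.2%:~R, 2 ^ (- I.1) * (I.2 + 1)%:~R[%classic.
Arguments ditv : clear implicits.

Definition child_left (I : dyadic) : dyadic := (I.1 + 1, 2 * I.2).
Definition child_right (I : dyadic) : dyadic := (I.1 + 1, 2 * I.2 + 1).

(* [divz] rounds down for a positive divisor, so this is the dyadic interval of
   length 2^n times that of I containing I, see [ditv_ancestor]. *)
Definition ancestor (n : nat) (I : dyadic) : dyadic :=
  (I.1 - n%:Z, (I.2 %/ 2 ^+ n)%Z).

Definition parent (I : dyadic) : dyadic := ancestor 1 I.

Definition descendants (n : nat) (I : dyadic) : set dyadic :=
  [set J | ancestor n J = I].

Definition descendants_le (n : nat) (I : dyadic) : set dyadic :=
  \bigcup_(k in [set k | (k <= n)%N]) descendants k I.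

Section Measure.
Context {R : realType}.
Variable mu : {measure set (measurableTypeR R) -> \bar R}.
Implicit Types (I J K : dyadic) (f g : R -> R) (S : set dyadic).

Definition dyadic_pos_finite : Prop :=
  forall I, (0 < mu (ditv R I) < +oo)%E.

Definition dmeas I : R := fine (mu (ditv R I)).

Definition pairing f g : R := \int[mu]_x (f x * g x).

Definition average f I : R := (dmeas I)^-1 * \int[mu]_(x in ditv R I) f x.

Definition mcoef I : R :=
  dmeas (child_left I) * dmeas (child_right I) / dmeas I.

(* An atom of a measure that is finite on bounded sets is, up to a null set, a
   point of positive measure. *)
Definition balanced : Prop :=
  (forall x : R, mu [set x] = 0%E) /\
  exists c : R, 1 <= c /\
    forall I, c^-1 * mcoef (parent I) <= mcoef I <= c * mcoef (parent I).

Definition haar I : R -> R := fun x =>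
  Num.sqrt (mcoef I) *
    (\1_(ditv R (child_left I)) x / dmeas (child_left I) -
     \1_(ditv R (child_right I)) x / dmeas (child_right I)).

(* Both sums have finite range, see [finite_descendants]. *)
Definition haar_block (s t : nat) (alpha : dyadic -> dyadic -> dyadic -> R)
    I f : R -> R := fun x =>
  \sum_(J \in descendants s I) \sum_(K \in descendants t I)
    alpha I J K * pairing f (haar J) * haar K x.

(* T acts on representatives of classes in L^2(mu), and the series over I
   converges to T f unconditionally in L^2(mu), that is, along the net of
   finite sets of dyadic intervals. *)
Definition haar_shift (s t : nat) (T : (R -> R) -> (R -> R)) : Prop :=
  exists alpha : dyadic -> dyadic -> dyadic -> R,
    (forall I J K, descendants s I J -> descendants t I K ->
       `|alpha I J K| <= 1) /\
    forall f, f \in Lfun mu 2%:E ->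
      T f \in Lfun mu 2%:E /\
      forall e : R, 0 < e -> exists F0 : {fset dyadic},
        forall F : {fset dyadic}, (F0 `<=` F)%fset ->
          ('N[mu]_2%:E[(fun x =>
             (T f x - \sum_(I <- F) haar_block s t alpha I f x)%:E)] <= e%:E)%E.

Definition sparse (eta : R) S : Prop :=
  exists E : dyadic -> set (measurableTypeR R),
    (forall I, S I -> [/\ measurable (E I), E I `<=` ditv R I &
       (eta%:E * mu (ditv R I) <= mu (E I))%E]) /\
    trivIset S E.

(* The two forms take values in the extended reals: they are unordered sums of
   nonnegative terms for nonnegative functions. *)
Definition form_A S f g : \bar R :=
  \esum_(I in S) (average f I * average g I * dmeas I)%:E.

Definition form_C S f g : \bar R :=
  \esum_(I in S) \esum_(J in S `&` descendants_le 2 (parent I))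
    ((average f I * average g J + average g I * average f J) * mcoef I)%:E.

Definition bounded_compact_support f : Prop :=
  [/\ measurable_fun [set: measurableTypeR R] f,
      exists M : R, forall x, `|f x| <= M &
      compact (closure [set x : R | f x != 0])].

End Measure.

Lemma ditv_ancestor (R : realType) (n : nat) (I : dyadic) :
  ditv R I `<=` ditv R (ancestor n I).
Proof.
case: I => k j x; rewrite /ditv /= !in_itv /= => /andP[h1 h2].
have p2 : (0 : int) < 2 ^+ n by rewrite exprn_gt0.
have -> : (2 : R) ^ (- (k - n%:Z)) = 2 ^ (- k) * (2 ^+ n)%:~R.
  by rewrite opprB addrC expfzDr // rmorphXn.
have p0 : (0 : R) < 2 ^ (- k) by rewrite exprz_gt0.
apply/andP; split.
  apply: le_trans h1; rewrite -mulrA ler_pM2l // -intrM ler_int mulrC.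
  by apply: lez_floor; rewrite gt_eqF.
apply: lt_le_trans h2 _; rewrite -mulrA ler_pM2l // -intrM ler_int mulrC.
by rewrite lezD1 ltz_ceil.
Qed.

Lemma ditv_inj (R : realType) : injective (ditv R).
Proof.
move=> [k j] [k' j'] /= e.
have lt_ends (a b : int) : (2 : R) ^ (- a) * b%:~R < 2 ^ (- a) * (b + 1)%:~R.
  by rewrite ltr_pM2l ?exprz_gt0 // ltr_int ltzD1.
have ei := congr1 inf e; have es := congr1 sup e.
rewrite /ditv /= !inf_itv ?bnd_simp ?lt_ends // in ei.
rewrite /ditv /= !sup_itv ?bnd_simp ?lt_ends // in es.
have ek : (2 : R) ^ (- k) = 2 ^ (- k').
  by move: es; rewrite !intrD !mulrDr !mulr1 ei => /addrI.
have kk : k = k'.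
  apply: oppr_inj; apply: (@ieexprIz R 2) => //.
  by rewrite gt_eqF // ltr1n.
subst k'; congr pair; apply/eqP; rewrite -(eqr_int R); apply/eqP.
by apply: (@mulfI _ ((2 : R) ^ (- k))) => //; rewrite gt_eqF // exprz_gt0.
Qed.

Lemma finite_descendants (n : nat) (I : dyadic) :
  finite_set (descendants n I).
Proof.
apply: (@sub_finite_set _ _
  [set (I.1 + n%:Z, I.2 * 2 ^+ n + r%:Z) | r in `I_(2 ^ n)%N]); last first.
  exact/finite_image/finite_II.
move=> [k j] /= <- /=.
have p2 : (0 : int) < 2 ^+ n by rewrite exprn_gt0.
have m0 : 0 <= (j %% 2 ^+ n)%Z by rewrite modz_ge0 // gt_eqF.
exists `|(j %% 2 ^+ n)%Z|%N.
  rewrite /= -ltz_nat gez0_abs //.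
  by apply: lt_le_trans (ltz_pmod _ p2) _; rewrite -natz natrX.
by rewrite gez0_abs // -divz_eq subrK.
Qed.

(* Main.v *)
Require Import Defs.
From mathcomp Require Import all_boot all_order all_algebra finmap.
From mathcomp Require Import all_classical all_reals all_analysis.
From mathcomp Require Import measurable_realfun.
From mathcomp Require Import ring lra zify.

Set Implicit Arguments.
Unset Strict Implicit.
Unset Printing Implicit Defensive.

Import Order.TTheory GRing.Theory Num.Theory.
Local Open Scope classical_set_scope.
Local Open Scope ring_scope.

(* By the unconditional convergence of T f1 it suffices to bound finitely many
   terms |<f1, h_J> <f2, h_K>|, where |<f, h_I>| is sqrt (m I) times the
   difference of the averages of f on the two children of I. From a generation
   above all of these intervals, select those whose average of f1 or f2 exceeds 4
   times the average on the last selected interval containing them; the selected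
   intervals are 1/2-sparse. Differences between unselected children are summed
   by a Bellman function, a variant of the energy identity
   m I * |difference|^2 = the increase of the squared averages, that tolerates
   stopping. The remaining products contain an average over a selected child Q;
   m being at most mu Q, those with a bounded average as the other factor give
   integrals over disjoint sets, hence form_A. A product of averages over a
   selected Q and over its sibling or a child of its sibling is a term of form_C,
   since the values of m at neighbouring intervals are comparable. *)

(** * Parents, children and siblings in the integer coding *)

Lemma parent_left (I : dyadic) : parent (child_left I) = I.
Proof. by case: I => k j; rewrite /parent /ancestor /child_left /=; congr pair; lia. Qed.

Lemma parent_right (I : dyadic) : parent (child_right I) = I.
Proof. by case: I => k j; rewrite /parent /ancestor /child_right /=; congr pair; lia. Qed.

(** The index goes up by one if it is even and down by one if it is odd. *)
Definition sibling (I : dyadic) : dyadic := (I.1, I.2 + 1 - 2 * (I.2 %% 2)%Z).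

Lemma sibling_left (I : dyadic) : sibling (child_left I) = child_right I.
Proof. by case: I => k j; rewrite /sibling /child_left /child_right /=; congr pair; lia. Qed.

Lemma sibling_right (I : dyadic) : sibling (child_right I) = child_left I.
Proof. by case: I => k j; rewrite /sibling /child_left /child_right /=; congr pair; lia. Qed.

Lemma parent_sibling (I : dyadic) : parent (sibling I) = parent I.
Proof. by case: I => k j; rewrite /sibling /parent /ancestor /=; congr pair; lia. Qed.

Lemma ancestor2_sibling_left I : ancestor 2 (child_left (sibling I)) = parent I.
Proof.
by case: I => a b; rewrite /sibling /parent /ancestor /child_left /=; congr pair; lia.
Qed.

Lemma ancestor2_sibling_right I : ancestor 2 (child_right (sibling I)) = parent I.
Proof.
by case: I => a b; rewrite /sibling /parent /ancestor /child_right /=; congr pair; lia.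
Qed.

(** * Sums over dyadic trees *)

Section TreeSums.
Context {R : realType}.
Implicit Types (I J : dyadic) (X Y V t : dyadic -> R) (n : nat).

(** Here n counts generations, that of I included, so n = 0 gives the empty sum. *)
Fixpoint tsum n X I : R :=
  if n is n'.+1 then
    X I + (tsum n' X (child_left I) + tsum n' X (child_right I))
  else 0.

Lemma le_tsum (k : int) n X Y I : (forall J, k <= J.1 -> X J <= Y J) ->
  k <= I.1 -> tsum n X I <= tsum n Y I.
Proof.
move=> XY; elim: n I => //= n ih I kI.
by rewrite !lerD ?XY ?ih //=; lia.
Qed.

Lemma tsum_ge0 n X I : (forall J, 0 <= X J) -> 0 <= tsum n X I.
Proof. by move=> X0; elim: n I => //= n ih I; rewrite !addr_ge0. Qed.

Lemma tsumD n X Y I : tsum n (fun J => X J + Y J) I = tsum n X I + tsum n Y I.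
Proof. by elim: n I => /= [I|n ih I]; rewrite ?addr0 // !ih; ring. Qed.

Lemma tsumZ n a X I : tsum n (fun J => a * X J) I = a * tsum n X I.
Proof. by elim: n I => /= [I|n ih I]; rewrite ?mulr0 // !ih; ring. Qed.

Lemma tsum_widen n X I : (forall J, 0 <= X J) -> tsum n X I <= tsum n.+1 X I.
Proof.
move=> X0; elim: n I => [I|n ih I]; first by rewrite tsum_ge0.
by rewrite [leLHS]/= [leRHS]/= lerD2l lerD.
Qed.

Lemma tsum_children n X I : (forall J, 0 <= X J) ->
  tsum n (fun J => X (child_left J)) I + tsum n (fun J => X (child_right J)) I
  <= tsum n.+1 X I.
Proof.
move=> X0; rewrite -tsumD.
(* The root term is kept to make the induction close: the hypotheses at the two children absorb the
   values of X there. *)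
have : X I + tsum n (fun J => X (child_left J) + X (child_right J)) I
  <= tsum n.+1 X I.
  elim: n I => [|n ih] I; first by rewrite /= !addr0.
  have := ih (child_left I); have := ih (child_right I).
  set Y := fun J => _; rewrite [tsum n.+1 Y I]/= [tsum n.+2 X I]/=.
  rewrite /Y -/Y /=; lra.
by have := X0 I; lra.
Qed.

End TreeSums.

(** * Stopping intervals and Bellman functions *)

Lemma child_of_parent (I : dyadic) :
  I = child_left (parent I) \/ I = child_right (parent I).
Proof.
case: I => k j; rewrite /parent /ancestor /child_left /child_right /=.
have [j2|j2] : (j %% 2)%Z = 0 \/ (j %% 2)%Z = 1 by lia.
  by left; congr pair; lia.
by right; congr pair; lia.
Qed.

Lemma parent_gen (I : dyadic) : (parent I).1 = I.1 - 1. Proof. by []. Qed.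

(** Expand the square of [Num.sqrt x * a - Num.sqrt y * b]. This splits a product of two Haar
    coefficients into two energies. *)
Lemma sqrt_mul_le (R : rcfType) (x y a b : R) : 0 <= x -> 0 <= y ->
  Num.sqrt x * Num.sqrt y * (a * b) <= (x * a ^+ 2 + y * b ^+ 2) / 2.
Proof.
move=> x0 y0; rewrite -{2}(sqr_sqrtr x0) -{2}(sqr_sqrtr y0).
have := sqr_ge0 (Num.sqrt x * a - Num.sqrt y * b).
set u := Num.sqrt x; set v := Num.sqrt y => h.
suff : (u * a - v * b) ^+ 2 = u ^+ 2 * a ^+ 2 + v ^+ 2 * b ^+ 2
  - 2 * (u * v * (a * b)) by move=> e; rewrite e in h; lra.
by ring.
Qed.

(* Here l and r are the averages on the two children, in units of the average on
   the current stopping interval, and bl, br tell whether the children are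
   stopped. The quadratic terms telescope like a variance; when a child is
   stopped, the linear term 8 u pays for the jump, and 16 keeps the Bellman
   function u |-> 16 + 8 u - u ^ 2 nonnegative on [0, 4]. *)
Lemma energy_node (R : realFieldType) (Ml Mr l r : R) (bl br : bool) : 0 < Ml -> 0 < Mr ->
  0 <= l -> 0 <= r -> (~~ bl -> l <= 4) -> (~~ br -> r <= 4) ->
  let u := (Ml * l + Mr * r) / (Ml + Mr) in u <= 4 ->
  Ml * Mr / (Ml + Mr) * ((1 - bl%:R) * l - (1 - br%:R) * r) ^+ 2
  + ((1 - bl%:R) * (Ml * (16 + 8 * l - l ^+ 2))
     + (1 - br%:R) * (Mr * (16 + 8 * r - r ^+ 2)))
  <= (Ml + Mr) * (16 + 8 * u - u ^+ 2).
Proof.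
move=> Ml0 Mr0 l0 r0 hl hr u u4.
have S0 : 0 < Ml + Mr by rewrite addr_gt0.
have Sn : Ml + Mr != 0 by rewrite gt_eqF.
have uE : (Ml + Mr) * u = Ml * l + Mr * r by rewrite /u; field.
have u0 : 0 <= u by rewrite /u divr_ge0 ?addr_ge0 ?mulr_ge0 // ltW.
have uu : (Ml + Mr) * u ^+ 2 = (Ml * l + Mr * r) * u by rewrite -uE; ring.
have -> : (Ml + Mr) * (16 + 8 * u - u ^+ 2) =
  16 * (Ml + Mr) + 8 * (Ml * l + Mr * r) - (Ml * l + Mr * r) * u.
  by rewrite -uu -uE; ring.
set w := Ml * Mr / _.
have w0 : 0 <= w by rewrite /w divr_ge0 ?mulr_ge0 // ltW.
have wl : w <= Ml by rewrite /w ler_pdivrMr //; nra.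
have wr : w <= Mr by rewrite /w ler_pdivrMr //; nra.
have ulr : Ml * (u - l) = w * (r - l) by rewrite /u /w; field.
have urr : Mr * (u - r) = w * (l - r) by rewrite /u /w; field.
case: bl br hl hr => [] [] //= hl hr; rewrite ?subrr ?subr0 ?mul0r ?mul1r ?subr0.
- have : (Ml * l + Mr * r) * u <= (Ml * l + Mr * r) * 4.
    by rewrite ler_wpM2l // addr_ge0 ?mulr_ge0 // ltW.
  by have := mulr_ge0 (ltW Ml0) l0; have := mulr_ge0 (ltW Mr0) r0; lra.
(* Only the left child is stopped. What remains to be paid is [w * (r * l)] and [Ml * l * u], each
   at most [4 * Ml * l] since r and u are at most 4; this uses up the coefficient 8. *)
- have {}hr := hr isT.
  have e : Mr * r * (r - u) = w * r ^+ 2 - w * (r * l).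
    by transitivity (- r * (Mr * (u - r))); [ring | rewrite urr; ring].
  have h1 : w * (r * l) <= Ml * (4 * l).
    by apply: ler_pM => //; [exact: mulr_ge0 | exact: ler_wpM2r].
  have h2 : Ml * l * u <= Ml * l * 4.
    by rewrite ler_wpM2l ?mulr_ge0 // ltW.
  by lra.
- have {}hl := hl isT.
  have e : Ml * l * (l - u) = w * l ^+ 2 - w * (l * r).
    by transitivity (- l * (Ml * (u - l))); [ring | rewrite ulr; ring].
  have h1 : w * (l * r) <= Mr * (4 * r).
    by apply: ler_pM => //; [exact: mulr_ge0 | exact: ler_wpM2r].
  have h2 : Mr * r * u <= Mr * r * 4.
    by rewrite ler_wpM2l ?mulr_ge0 // ltW.
  by lra.
(* No child is stopped: both sides agree, by the variance identity. *)
- have e1 : Ml * l * (u - l) = w * (l * (r - l)).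
    by transitivity (l * (Ml * (u - l))); [ring | rewrite ulr; ring].
  have e2 : Mr * r * (u - r) = w * (r * (l - r)).
    by transitivity (r * (Mr * (u - r))); [ring | rewrite urr; ring].
  by lra.
Qed.

Section Stopping.
Context {R : realType}.
Implicit Types (I J : dyadic) (n : nat).

(* h I plays the role of the average on I, with respect to a measure M, of a
   nonnegative function. *)
Definition martingale (M h : dyadic -> R) := forall I,
  0 <= h I /\
  M I * h I =
  M (child_left I) * h (child_left I) + M (child_right I) * h (child_right I).

Variables (M f g : dyadic -> R) (k : int).
Hypothesis M_gt0 : forall I, 0 < M I.
Hypothesis M_add : forall I, M I = M (child_left I) + M (child_right I).
Hypothesis f_mart : martingale M f.
Hypothesis g_mart : martingale M g.

Lemma martingale_ge0 h I : martingale M h -> 0 <= h I.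
Proof. by case/(_ I). Qed.

Lemma martingale_child0 h I : martingale M h -> h (parent I) = 0 -> h I = 0.
Proof.
move=> hm h0; have [_] := hm (parent I); rewrite h0 mulr0 => /esym/eqP.
have h_ge0 J : 0 <= M J * h J by rewrite mulr_ge0 ?(ltW (M_gt0 _))//; case: (hm J).
rewrite paddr_eq0 ?h_ge0 // !mulf_eq0.
have M0 J : (M J == 0) = false by rewrite gt_eqF.
by rewrite !M0 /= => /andP[/eqP ? /eqP ?]; have [->|->] := child_of_parent I.
Qed.

Definition exceeds J I := (4 * f J < f I) || (4 * g J < g I).

(* [stop I] is the smallest selected interval containing I, where the selection
   starts from the generation k; it is meaningless above that generation. *)
Fixpoint stop_rec n I : dyadic :=
  if n is n'.+1 then
    let p := stop_rec n' (parent I) in if exceeds p I then I else p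
  else I.

Definition stop I := stop_rec `|I.1 - k|%N I.

Definition selected I := stop I == I.

Lemma stop_rec_gen n I : (stop_rec n I).1 <= I.1.
Proof.
elim: n I => //= n ih I; case: ifP => // _.
by apply: le_trans (ih _) _; rewrite parent_gen; lia.
Qed.

Lemma stop_root I : I.1 = k -> stop I = I.
Proof. by rewrite /stop => ->; rewrite subrr. Qed.

Lemma stop_childE I c : parent c = I -> k <= I.1 ->
  stop c = if exceeds (stop I) c then c else stop I.
Proof.
move=> cI kI; have c1 : c.1 = I.1 + 1 by rewrite -cI parent_gen; lia.
rewrite {1}/stop; have -> : `|c.1 - k|%N = `|I.1 - k|.+1 by lia.
by rewrite /= cI.
Qed.

(** A child that fails the test inherits the stopping interval of its parent; by its generation,
    this interval cannot be the child. *)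
Lemma selected_childE I c : parent c = I -> k <= I.1 ->
  selected c = exceeds (stop I) c.
Proof.
move=> cI kI; rewrite /selected (stop_childE cI kI); case: ifP => _.
  exact: eqxx.
apply/eqP => e; have := stop_rec_gen `|I.1 - k|%N I.
by rewrite -/(stop I) e -cI parent_gen; lia.
Qed.

Lemma stop_child I c : parent c = I -> k <= I.1 ->
  stop c = if selected c then c else stop I.
Proof. by move=> cI kI; rewrite (selected_childE cI kI) (stop_childE cI kI). Qed.

Lemma stop_selected I : selected I -> stop I = I.
Proof. by move/eqP. Qed.

Definition controlled (h : dyadic -> R) := forall I, h I <= 4 * h (stop I).

(** Either [stop I] is I, and nonnegativity suffices, or I failed the test [exceeds] against
    [stop I]. *)
Lemma controlled_fg : controlled f /\ controlled g.
Proof.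
have x4 (x : R) : 0 <= x -> x <= 4 * x by lra.
have fx I := x4 _ (proj1 (f_mart I)); have gx I := x4 _ (proj1 (g_mart I)).
split=> I; rewrite /stop; case: `|_|%N => [|n] //=; case: ifP => //.
  by move=> /negbT; rewrite negb_or -!leNgt => /andP[].
by move=> /negbT; rewrite negb_or -!leNgt => /andP[].
Qed.

(** A vanishing average of a nonnegative function vanishes on all descendants, and [stop I] is an
    ancestor of I. Hence an interval is never selected against a zero average, and quotients by
    [h (stop I)] are harmless. *)
Lemma stop0 h I : martingale M h -> h (stop I) = 0 -> h I = 0.
Proof.
move=> hm; rewrite /stop; move: (absz _) => n; elim: n I => [|n ih] I //=.
by case: ifP => // _ /ih; exact: martingale_child0.
Qed.

Notation s I := ((selected I)%:R : R).

(* Bellman's argument: V I dominates t I plus the values of V at those children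
   that are not selected, so that only the selected intervals restart V. *)
Lemma tsum_bellman n (t V : dyadic -> R) I : (forall J, 0 <= V J) ->
  (forall J, k <= J.1 -> t J + ((1 - s (child_left J)) * V (child_left J)
     + (1 - s (child_right J)) * V (child_right J)) <= V J) ->
  k <= I.1 -> tsum n t I <= (1 - s I) * V I + tsum n (fun J => s J * V J) I.
Proof.
move=> V0 tV; elim: n I => /= [|n ih] I kI.
  by rewrite addr0; case: selected; rewrite /= ?subrr ?mul0r // subr0 mul1r.
have kl : k <= (child_left I).1 by rewrite /=; lia.
have kr : k <= (child_right I).1 by rewrite /=; lia.
by have := ih _ kl; have := ih _ kr; have := tV _ kI; lra.
Qed.

(** This is [mcoef] when M is [dmeas mu]. *)
Definition mweight I := M (child_left I) * M (child_right I) / M I.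

(* Averages over selected children may be arbitrarily large, as M need not be
   doubling; they are removed here and estimated separately. *)
Definition trunc (h : dyadic -> R) I := (1 - s I) * h I.
Definition trunc_diff h I := `|trunc h (child_left I) - trunc h (child_right I)|.

(** The difference is normalised by the stopping average and weighted by the product of both
    stopping averages, so that energies of f and of g are on the same scale and both sum to the
    mass. *)
Definition energy h I :=
  f (stop I) * g (stop I) * (mweight I * (trunc_diff h I / h (stop I)) ^+ 2).


Definition mass I := s I * (f I * g I * M I).

(** The average of h1 is still taken over the old stopping interval, while the integral of h2 is
    over a newly selected child. *)
Definition jump (h1 h2 : dyadic -> R) I :=
  s (child_left I) * (h1 (stop I) * (M (child_left I) * h2 (child_left I))) +
  s (child_right I) * (h1 (stop I) * (M (child_right I) * h2 (child_right I))).

Let M_ge0 I : 0 <= M I. Proof. exact: ltW. Qed.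
Let f_ge0 I : 0 <= f I. Proof. exact: martingale_ge0. Qed.
Let g_ge0 I : 0 <= g I. Proof. exact: martingale_ge0. Qed.
Local Hint Resolve M_ge0 f_ge0 g_ge0 : core.

Lemma mweight_gt0 I : 0 < mweight I.
Proof. by rewrite /mweight divr_gt0 // mulr_gt0. Qed.

Lemma mweight_left I : mweight I <= M (child_left I).
Proof.
rewrite /mweight ler_pdivrMr // ler_pM2l // [leRHS]M_add lerDr.
exact: ltW.
Qed.

Lemma mweight_right I : mweight I <= M (child_right I).
Proof.
rewrite /mweight ler_pdivrMr // [leRHS]mulrC ler_pM2r // [leRHS]M_add lerDl.
exact: ltW.
Qed.

Lemma mass_ge0 I : 0 <= mass I.
Proof. by rewrite !mulr_ge0. Qed.

Lemma jump_ge0 h1 h2 I : martingale M h1 -> martingale M h2 -> 0 <= jump h1 h2 I.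
Proof.
move=> h1m h2m; have h10 J := martingale_ge0 J h1m.
by have h20 J := martingale_ge0 J h2m; rewrite addr_ge0 // !mulr_ge0.
Qed.

Lemma energy_ge0 h I : 0 <= energy h I.
Proof.
by apply: mulr_ge0; apply: mulr_ge0; rewrite ?sqr_ge0 // ltW // mweight_gt0.
Qed.

Lemma div_controlled h I J : martingale M h -> h I <= 4 * h J ->
  0 <= h I / h J <= 4.
Proof.
move=> hm hIJ; rewrite divr_ge0 ?(martingale_ge0 _ hm) //=.
have [->|h0] := eqVneq (h J) 0; first by rewrite invr0 mulr0.
have hJ : 0 < h J by rewrite lt_def h0 (martingale_ge0 _ hm).
by rewrite ler_pdivrMr.
Qed.

Lemma tsum_energy n h I : martingale M h -> controlled h ->
  k <= I.1 -> selected I ->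
  tsum n (energy h) I <= 23 * tsum n mass I.
Proof.
move=> hm hc kI sI; have h_ge0 J := martingale_ge0 J hm.
(* The Bellman function of [energy_node] at the average of h in units of its stopping average. *)
pose V J := f (stop J) * g (stop J) *
  (M J * (16 + 8 * (h J / h (stop J)) - (h J / h (stop J)) ^+ 2)).
have V0 J : 0 <= V J.
  rewrite /V !mulr_ge0 //.
  by have /andP[u0 u4] := div_controlled hm (hc J); nra.
have -> : 23 * tsum n mass I = tsum n (fun J => 23 * mass J) I by rewrite tsumZ.
apply: (@le_trans _ _ ((1 - s I) * V I + tsum n (fun J => s J * V J) I)); last first.
  rewrite sI subrr mul0r add0r; apply: (@le_tsum _ k) => // J kJ.
  rewrite /mass /V; case: (boolP (selected J)) => sJ; last by rewrite !mul0r mulr0.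
  rewrite (stop_selected sJ) !mul1r -mulrA [leRHS]mulrC -!mulrA.
  do 3! (rewrite ler_wpM2l  //).
  (* At a selected J the normalised average is 1, with Bellman value 16 + 8 - 1 = 23, or 0 by the
     convention for division if h J vanishes, with value 16. *)
  have [->|h0] := eqVneq (h J) 0; first by rewrite !mul0r; lra.
  by rewrite divff //; lra.
apply: tsum_bellman => // J kJ.
set p := stop J; set l := child_left J; set r := child_right J.
have VE c : parent c = J -> (1 - s c) * V c = f p * g p * ((1 - s c) *
  (M c * (16 + 8 * (h c / h p) - (h c / h p) ^+ 2))).
  move=> cJ; rewrite /V (stop_child cJ kJ); case: selected => /=.
    by rewrite subrr !mul0r mulr0.
  by rewrite -/p; ring.
rewrite (VE l (parent_left J)) (VE r (parent_right J)) /energy -/p.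
rewrite -!mulrDr /V -/p ler_wpM2l ?mulr_ge0 //.
have hp4 c : parent c = J -> ~~ selected c -> h c / h p <= 4.
  move=> cJ sc; have := hc c; rewrite (stop_child cJ kJ) (negbTE sc) -/p.
  by move=> /(div_controlled hm) /andP[].
have uE : h J / h p = (M l * (h l / h p) + M r * (h r / h p)) / (M l + M r).
  rewrite -M_add !mulrA -mulrDl -(proj2 (hm J)).
  by rewrite [RHS]mulrAC [M J * h J]mulrC mulfK // gt_eqF.
have -> : trunc_diff h J / h p = `|(1 - s l) * (h l / h p) - (1 - s r) * (h r / h p)|.
  rewrite /trunc_diff /trunc -/l -/r !mulrA -mulrBl normrM.
  by rewrite (@ger0_norm _ (h p)^-1) // invr_ge0.
rewrite real_normK ?num_real // /mweight -/l -/r.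
have := @energy_node _ (M l) (M r) (h l / h p) (h r / h p)
  (selected l) (selected r)
  (M_gt0 l) (M_gt0 r).
rewrite /= -uE -M_add; apply.
- by rewrite divr_ge0.
- by rewrite divr_ge0.
- exact/hp4/parent_left.
- exact/hp4/parent_right.
- by have /andP[] := div_controlled hm (hc J).
Qed.

(** The integral of h2 over J splits between the children: the selected ones take their share as a
    jump, the others pass it on in V with the same stopping average of h1. Nothing is counted twice
    until a selected interval restarts V. *)
Lemma tsum_jump n h1 h2 I : martingale M h1 -> martingale M h2 ->
  k <= I.1 -> selected I ->
  tsum n (jump h1 h2) I <= tsum n (fun J => s J * (h1 J * h2 J * M J)) I.
Proof.
move=> h1m h2m kI sI; have h10 J := martingale_ge0 J h1m.
have h20 J := martingale_ge0 J h2m.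
pose V J := h1 (stop J) * (M J * h2 J).
apply: (@le_trans _ _ ((1 - s I) * V I + tsum n (fun J => s J * V J) I)); last first.
  rewrite sI subrr mul0r add0r; apply: (@le_tsum _ k) => // J kJ.
  rewrite /V; case: (boolP (selected J)) => sJ; last by rewrite !mul0r.
  by rewrite (stop_selected sJ) !mul1r -mulrA [h2 J * _]mulrC.
apply: tsum_bellman => // J; first by rewrite !mulr_ge0.
move=> kJ; rewrite /jump /V (proj2 (h2m J)).
rewrite (stop_child (parent_left J) kJ) (stop_child (parent_right J) kJ).
by case: (selected (child_left J)); case: (selected (child_right J)); rewrite /=; lra.
Qed.


Lemma trunc_le h I c : martingale M h -> controlled h -> parent c = I ->
  k <= I.1 -> 0 <= trunc h c <= 4 * h (stop I).
Proof.
move=> hm hc cI kI; have h0 J := martingale_ge0 J hm.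
have := hc c; rewrite (stop_child cI kI) /trunc.
case: selected => /= hcI; first by rewrite subrr mul0r lexx mulr_ge0.
by rewrite subr0 mul1r h0.
Qed.

Lemma trunc_diff_le h I : martingale M h -> controlled h ->
  k <= I.1 -> trunc_diff h I <= 4 * h (stop I).
Proof.
move=> hm hc kI; rewrite /trunc_diff ler_norml.
have /andP[? ?] := trunc_le hm hc (parent_left I) kI.
have /andP[? ?] := trunc_le hm hc (parent_right I) kI.
by apply/andP; split; lra.
Qed.

Lemma diff_le h I : martingale M h ->
  `|h (child_left I) - h (child_right I)| <= trunc_diff h I
    + (s (child_left I) * h (child_left I) + s (child_right I) * h (child_right I)).
Proof.
move=> hm; have h0 J := martingale_ge0 J hm.
set l := child_left I; set r := child_right I.
have -> : h l - h r = (trunc h l - trunc h r) + (s l * h l - s r * h r).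
  by rewrite /trunc; ring.
apply: le_trans (ler_normD _ _) _; rewrite lerD2l.
apply: le_trans (ler_normB _ _) _.
by rewrite !ger0_norm ?mulr_ge0.
Qed.

(** For averages of a function this is the modulus of its pairing with the Haar function, see
    [haar_coefE]. *)
Definition haar_coef (h : dyadic -> R) I :=
  Num.sqrt (mweight I) * `|h (child_left I) - h (child_right I)|.

(** With a common stopping interval the stopping averages of f and g factor out, and [sqrt_mul_le]
    applies to the normalised differences. *)
Lemma trunc_diff_energy I J : k <= I.1 -> k <= J.1 -> stop I = stop J ->
  Num.sqrt (mweight I) * Num.sqrt (mweight J) * (trunc_diff f I * trunc_diff g J)
  <= (energy f I + energy g J) / 2.
Proof.
move=> kI kJ IJ; have [fc gc] := controlled_fg.
(* If the stopping average is 0, so is the truncated difference by [trunc_diff_le], and the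
   factorisation survives the division by 0. *)
have td_fac h K : martingale M h -> controlled h -> k <= K.1 ->
    trunc_diff h K = h (stop K) * (trunc_diff h K / h (stop K)).
  move=> hm hc kK; have [h0|h0] := eqVneq (h (stop K)) 0; last by field.
  apply/eqP; rewrite h0 mul0r eq_le; apply/andP; split; last exact: normr_ge0.
  by have := trunc_diff_le hm hc kK; rewrite h0 mulr0.
rewrite (td_fac f I) // (td_fac g J) // /energy -!IJ.
have := sqrt_mul_le (trunc_diff f I / f (stop I)) (trunc_diff g J / g (stop I))
  (ltW (mweight_gt0 I)) (ltW (mweight_gt0 J)).
set a := _ / f _; set b := _ / g _ => h.
have := ler_wpM2l (mulr_ge0 (f_ge0 (stop I)) (g_ge0 (stop I))) h; lra.
Qed.

(** * Estimates of a single block for balanced weights *)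

Variable C : R.
Hypothesis C_ge1 : 1 <= C.
Hypothesis mweight_balanced : forall I,
  mweight (parent I) <= C * mweight I /\ mweight I <= C * mweight (parent I).

(* The part of the inner sum of [form_C] that the proof uses. *)
Definition inner I :=
  let c := sibling I in
  f I * mweight I * (s c * g c
    + (s (child_left c) * g (child_left c)
       + s (child_right c) * g (child_right c))).

Lemma inner_ge0 I : 0 <= inner I.
Proof.
rewrite /inner /=; apply: mulr_ge0; first by rewrite mulr_ge0 // ltW // mweight_gt0.
by rewrite !addr_ge0 ?mulr_ge0.
Qed.

(** The geometric mean is at most the arithmetic mean, and each of the two weights is at most C
    times either of them. *)
Lemma sqrt_m_le I c : parent c = I ->
  Num.sqrt (mweight I) * Num.sqrt (mweight c) <= C * mweight I /\
  Num.sqrt (mweight I) * Num.sqrt (mweight c) <= C * mweight c.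
Proof.
move=> cI; have := mweight_balanced c; rewrite cI => -[h1 h2].
have := sqr_sqrtr (ltW (mweight_gt0 I)); have := sqr_sqrtr (ltW (mweight_gt0 c)).
have := sqrtr_ge0 (mweight I); have := sqrtr_ge0 (mweight c).
set u := Num.sqrt (mweight I); set v := Num.sqrt (mweight c) => v0 u0 vE uE.
have uv : u * v <= (u ^+ 2 + v ^+ 2) / 2 by have := sqr_ge0 (u - v); lra.
have mI := mweight_gt0 I; have mc := mweight_gt0 c.
have : mweight I <= C * mweight I by rewrite ler_peMl // ltW.
have : mweight c <= C * mweight c by rewrite ler_peMl // ltW.
by split; lra.
Qed.

(** The facts about c and its sibling are hypotheses so that c may be either child of I. Both
    differences are split by [diff_le], and the product is expanded. *)
Lemma pair_estimate I c : parent c = I ->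
  mweight I <= M c -> mweight I <= M (sibling c) ->
  sibling (sibling c) = c ->
  `|f (child_left I) - f (child_right I)| <=
    trunc_diff f I + (s c * f c + s (sibling c) * f (sibling c)) ->
  k <= I.1 ->
  haar_coef f I * haar_coef g c <=
    (energy f I + energy g c) / 2
    + 20 * C * (s c * (f (stop I) * (M c * g c)))
    + 4 * C * jump f g c + 5 * C * mass c
    + 4 * C * (s (sibling c) * (g (stop I) * (M (sibling c) * f (sibling c))))
    + 4 * C ^+ 2 * (s (sibling c) * inner (sibling c)).
Proof.
set b := sibling c => cI mIc mIb bc fI kI.
have [fc gc] := controlled_fg.
have kc : k <= c.1 by move: kI; rewrite -cI parent_gen; lia.
have [qI qc] := sqrt_m_le cI.
have gD := diff_le c g_mart.
have xp := trunc_diff_le f_mart fc kI; have yP := trunc_diff_le g_mart gc kc.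
have x0 : 0 <= trunc_diff f I by exact: normr_ge0.
have y0 : 0 <= trunc_diff g c by exact: normr_ge0.
have sE := stop_child cI kI.
have xy := @trunc_diff_energy I c kI kc.
have ml := mweight_left c; have mr := mweight_right c.
have gM := proj2 (g_mart c).
have bI : parent b = I by rewrite parent_sibling.
have mb : mweight I <= C * mweight b by have := mweight_balanced b; rewrite bI; case.
have q0 : 0 <= Num.sqrt (mweight I) * Num.sqrt (mweight c).
  by rewrite mulr_ge0 ?sqrtr_ge0.
have eI := energy_ge0 f I; have ec := energy_ge0 g c.
rewrite /haar_coef mulrACA.
apply: le_trans (ler_wpM2l q0 (ler_pM (normr_ge0 _) (normr_ge0 _) fI gD)) _.
rewrite /jump /mass /inner bc.
set q := _ * Num.sqrt _ in q0 qI qc xy *.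
set x := trunc_diff f I in xp x0 xy *; set y := trunc_diff g c in yP y0 xy *.
set l := child_left c in ml gM *; set r := child_right c in mr gM *.
have C0 : 0 <= C by exact: le_trans C_ge1.
have H0 M' z0 z : 0 <= z0 -> z0 <= z -> q <= C * M' -> q * z0 <= C * M' * z.
  by move=> z00 z0z qM; apply: ler_pM.
have H1 M' a A z0 z : 0 <= z0 -> z0 <= z -> 0 <= a -> a <= 4 * A -> q <= C * M' ->
    q * a * z0 <= 4 * C * (A * (M' * z)).
  move=> z00 z0z a0 aA qM; have -> : 4 * C * (A * (M' * z)) = C * M' * (4 * A) * z.
    by ring.
  by apply: ler_pM => //; [exact: mulr_ge0 | exact: ler_pM].
have qMl : q <= C * M l by apply: le_trans qc _; rewrite ler_wpM2l.
have qMr : q <= C * M r by apply: le_trans qc _; rewrite ler_wpM2l.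
have qMc : q <= C * M c by apply: le_trans qI _; rewrite ler_wpM2l.
have qMb : q <= C * M b by apply: le_trans qI _; rewrite ler_wpM2l.
have qmb : q <= C * (C * mweight b) by apply: le_trans qI _; rewrite ler_wpM2l.
have sf J : 0 <= s J * f J by rewrite mulr_ge0.
have sg J : 0 <= s J * g J by rewrite mulr_ge0.
have sgle J : s J * g J <= g J by case: selected; rewrite ?mul1r ?mul0r.
have A6 := H0 _ _ _ (mulr_ge0 (sf b) (addr_ge0 (sg l) (sg r))) (lexx _) qmb.
have P6 : 0 <= C * (C * mweight b) * (s b * f b * (s l * g l + s r * g r)).
  by apply: le_trans A6; rewrite !mulr_ge0 // addr_ge0.
(* If c is selected, [stop c] is c. Then x * y costs 16 C and x with the values of g on l and r
   another 4 C, together 20 C; f c with the same factors costs 4 C + C = 5 C. Products with f b go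
   into [inner b] by balance, used twice, whence C ^+ 2. *)
move: sE; case: (boolP (selected c)) => sc /= sE; rewrite ?sE in yP xy *.
- have A1 := H1 _ _ _ _ _ y0 yP x0 xp qMc.
  have A2l := H1 _ _ _ _ _ (sg l) (sgle l) x0 xp qMl.
  have A2r := H1 _ _ _ _ _ (sg r) (sgle r) x0 xp qMr.
  have A2 : C * (f (stop I) * (M c * g c)) =
    C * (f (stop I) * (M l * g l)) + C * (f (stop I) * (M r * g r)).
    by rewrite gM; ring.
  have A3 := H1 _ _ _ _ _ (f_ge0 c) (lexx _) y0 yP qMc.
  have A4 := H1 _ _ _ _ _ (sf b) (lexx _) y0 yP qmb.
  have A5l := H0 _ _ _ (mulr_ge0 (f_ge0 c) (sg l))
    (ler_wpM2l (f_ge0 c) (sgle l)) qMl.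
  have A5r := H0 _ _ _ (mulr_ge0 (f_ge0 c) (sg r))
    (ler_wpM2l (f_ge0 c) (sgle r)) qMr.
  have A5 : C * (f c * (M c * g c)) = C * (f c * (M l * g l)) + C * (f c * (M r * g r)).
    by rewrite gM; ring.
  have J0 := mulr_ge0 C0 (jump_ge0 c f_mart g_mart).
  rewrite /jump -/l -/r sE in J0.
  have B0 : 0 <= C * (s b * (g (stop I) * (M b * f b))) by rewrite !mulr_ge0.
  by clear -A1 A2l A2r A2 A3 A4 A5l A5r A5 A6 P6 J0 B0 eI ec; lra.
(* If c is not selected, I and c share their stopping interval: x * y splits into energies. The
   other terms are jumps, except f b against selected children of c, which belongs to [inner b]. *)
- have A1 := xy erefl.
  have A2l := H1 _ _ _ _ _ (sg l) (lexx _) x0 xp qMl.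
  have A2r := H1 _ _ _ _ _ (sg r) (lexx _) x0 xp qMr.
  have A4 := H1 _ _ _ _ _ (sf b) (lexx _) y0 yP qMb.
  by clear -A1 A2l A2r A4 A6 P6; lra.
Qed.


Notation si := (fun J => s J * inner J).

(** Adding [pair_estimate] over both children, the terms at a selected child and at its sibling
    recombine into jumps at I. *)
Lemma block01_le I : k <= I.1 ->
  haar_coef f I * (haar_coef g (child_left I) + haar_coef g (child_right I)) <=
  energy f I + 2^-1 * (energy g (child_left I) + energy g (child_right I))
  + 20 * C * jump f g I
  + 4 * C * (jump f g (child_left I) + jump f g (child_right I))
  + 5 * C * (mass (child_left I) + mass (child_right I))
  + 4 * C * jump g f I
  + 4 * C ^+ 2 * (si (child_left I) + si (child_right I)).
Proof.
move=> kI; have fD := diff_le I f_mart.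
have pl := @pair_estimate I (child_left I) (parent_left I) (mweight_left I).
have pr := @pair_estimate I (child_right I) (parent_right I) (mweight_right I).
rewrite !sibling_left ?sibling_right in pl pr.
have {}pl := pl (mweight_right I) erefl fD kI.
have {}pr := pr (mweight_left I) (sibling_left I).
rewrite [_ * f _ + _]addrC in pr; have {}pr := pr fD kI.
have jE h1 h2 : jump h1 h2 I =
    s (child_left I) * (h1 (stop I) * (M (child_left I) * h2 (child_left I))) +
    s (child_right I) * (h1 (stop I) * (M (child_right I) * h2 (child_right I))).
  by [].
rewrite mulrDr !jE; lra.
Qed.

(** Products over the same selected child go to the mass, as m is at most the measure of a child;
    products over two different selected children go to [inner] by balance. *)
Lemma block00_le I : k <= I.1 ->
  haar_coef f I * haar_coef g I <=
  2^-1 * (energy f I + energy g I) + 4 * jump f g I + 4 * jump g f I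
  + (mass (child_left I) + mass (child_right I))
  + C * (si (child_left I) + si (child_right I)).
Proof.
move=> kI; have [fc gc] := controlled_fg.
have fD := diff_le I f_mart; have gD := diff_le I g_mart.
have xp := trunc_diff_le f_mart fc kI; have yp := trunc_diff_le g_mart gc kI.
have x0 : 0 <= trunc_diff f I by exact: normr_ge0.
have y0 : 0 <= trunc_diff g I by exact: normr_ge0.
have xy := @trunc_diff_energy I I kI kI erefl.
have mI := ltW (mweight_gt0 I).
have mE : Num.sqrt (mweight I) * Num.sqrt (mweight I) = mweight I.
  by rewrite -expr2 sqr_sqrtr.
rewrite mE in xy; rewrite /haar_coef mulrACA mE.
apply: le_trans (ler_wpM2l mI (ler_pM (normr_ge0 _) (normr_ge0 _) fD gD)) _.
have ml := mweight_left I; have mr := mweight_right I.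
have bl : mweight I <= C * mweight (child_left I).
  by have := mweight_balanced (child_left I); rewrite parent_left; case.
have br : mweight I <= C * mweight (child_right I).
  by have := mweight_balanced (child_right I); rewrite parent_right; case.
rewrite /jump /mass /inner sibling_left sibling_right /=.
set x := trunc_diff f I in xp x0 xy *; set y := trunc_diff g I in yp y0 xy *.
set l := child_left I in ml bl *; set r := child_right I in mr br *.
have C0 : 0 <= C by exact: le_trans C_ge1.
have sf J : 0 <= s J * f J by rewrite mulr_ge0.
have sg J : 0 <= s J * g J by rewrite mulr_ge0.
have H1 M' a A z : 0 <= z -> 0 <= a -> a <= 4 * A -> mweight I <= M' ->
    mweight I * a * z <= 4 * (A * (M' * z)).
  move=> z0 a0 aA qM; have -> : 4 * (A * (M' * z)) = M' * (4 * A) * z by ring.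
  by apply: ler_pM => //; [exact: mulr_ge0 | exact: ler_pM].
have H0 M' J K : mweight I <= M' -> mweight I * (s J * f J * (s K * g K)) <=
    M' * (s J * f J * (s K * g K)).
  by move=> ?; apply: ler_wpM2r => //; exact: mulr_ge0.
have H2 M' J : mweight I <= M' ->
    mweight I * (s J * f J * (s J * g J)) <= s J * (f J * g J * M').
  move=> /H0/le_trans; apply.
  by case: selected; rewrite /= ?mul1r ?mul0r ?mulr0 // mulrC.
have B1 := H1 _ _ _ _ (sg l) x0 xp ml.
have B2 := H1 _ _ _ _ (sg r) x0 xp mr.
have B3 := H1 _ _ _ _ (sf l) y0 yp ml.
have B4 := H1 _ _ _ _ (sf r) y0 yp mr.
have B5 := H2 _ l ml; have B6 := H2 _ r mr.
have B7 := H0 _ l r bl; have B8 := H0 _ r l br.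
have N J K : 0 <= C * (s J * (f J * mweight J * (s K * g K))).
  have mJ := ltW (mweight_gt0 J); apply: mulr_ge0 => //.
  by apply: mulr_ge0 => //; apply: mulr_ge0 => //; apply: mulr_ge0.
have N1 := N l (child_left r); have N2 := N l (child_right r).
have N3 := N r (child_left l); have N4 := N r (child_right l).
by clear -xy B1 B2 B3 B4 B5 B6 B7 B8 N1 N2 N3 N4; lra.
Qed.

(** * Summation of the block estimates over a tree *)

Lemma tsum_mass_le n I : tsum n mass I <= tsum n.+1 mass I.
Proof. exact/tsum_widen/mass_ge0. Qed.

Lemma tsum_energies n I : k <= I.1 -> selected I ->
  [/\ tsum n (energy f) I <= 23 * tsum n mass I,
      tsum n (energy g) I <= 23 * tsum n mass I,
      tsum n (jump f g) I <= tsum n mass I &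
      tsum n (jump g f) I <= tsum n mass I].
Proof.
move=> kI sI; have [fc gc] := controlled_fg; split.
- exact: tsum_energy.
- exact: tsum_energy.
- exact: tsum_jump.
apply: le_trans (tsum_jump n g_mart f_mart kI sI) _.
by apply: (@le_tsum _ k) => // J _; rewrite /mass [g J * f J]mulrC.
Qed.

Lemma tsum_block01 n I : k <= I.1 -> selected I ->
  tsum n (fun J => haar_coef f J *
    (haar_coef g (child_left J) + haar_coef g (child_right J))) I <=
  100 * C ^+ 2 * (tsum n.+1 mass I + tsum n.+1 si I).
Proof.
(* The mass collects 23 + 23/2 from the energies and (20 + 4 + 5 + 4) C from jumps and masses, below
   100 C ^+ 2 as C is at least 1. Terms at children cost one more generation. *)
move=> kI sI; apply: le_trans (le_tsum n block01_le kI) _.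
have [E1 _ J1 J2] := tsum_energies n kI sI.
have [_ E2 J3 _] := tsum_energies n.+1 kI sI.
have := @tsum_children _ n (energy g) I (energy_ge0 g).
have := @tsum_children _ n (jump f g) I (fun J => jump_ge0 J f_mart g_mart).
have := @tsum_children _ n mass I mass_ge0.
have si0 J : 0 <= si J by rewrite mulr_ge0 ?inner_ge0.
have := @tsum_children _ n si I si0.
have w := tsum_mass_le n I; have M0 := tsum_ge0 n.+1 I mass_ge0.
have S0 := tsum_ge0 n.+1 I si0.
have C0 : 0 <= C by exact: le_trans C_ge1.
move: E1 E2 J1 J2 J3 w M0 S0;
move: (jump f g) (jump g f) (energy f) (energy g) (mass) si => j1 j2 e1 e2 a b.
rewrite !(tsumD, tsumZ).
move: (tsum _ a I) (tsum _ a I) (tsum _ b I).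
move=> A1 A0 S1 E1 E2 J1 J2 J3 w M0 S0 S2 A2 J4 E3.
have lC (x y : R) : x <= y -> C * x <= C * y by exact: ler_wpM2l.
have {}J1 := lC _ _ (le_trans J1 w); have {}J2 := lC _ _ (le_trans J2 w).
have {}J4 := lC _ _ (le_trans J4 J3); have {}A2 := lC _ _ A2.
have {}S2 := ler_wpM2l (sqr_ge0 C) S2.
have CA : C * A1 <= C ^+ 2 * A1 by rewrite ler_wpM2r // expr2 ler_peMl.
have A1C : A1 <= C * A1 by rewrite ler_peMl.
have S1C : 0 <= C ^+ 2 * S1 by rewrite mulr_ge0 // sqr_ge0.
by lra.
Qed.

Lemma tsum_block00 n I : k <= I.1 -> selected I ->
  tsum n (fun J => haar_coef f J * haar_coef g J) I <=
  100 * C ^+ 2 * (tsum n.+1 mass I + tsum n.+1 si I).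
Proof.
move=> kI sI; apply: le_trans (le_tsum n block00_le kI) _.
have [E1 E2 J1 J2] := tsum_energies n kI sI.
have := @tsum_children _ n mass I mass_ge0.
have si0 J : 0 <= si J by rewrite mulr_ge0 ?inner_ge0.
have := @tsum_children _ n si I si0.
have w := tsum_mass_le n I; have M0 := tsum_ge0 n.+1 I mass_ge0.
have S0 := tsum_ge0 n.+1 I si0.
have C0 : 0 <= C by exact: le_trans C_ge1.
move: E1 E2 J1 J2 w M0 S0;
move: (jump f g) (jump g f) (energy f) (energy g) (mass) si => j1 j2 e1 e2 a b.
rewrite !(tsumD, tsumZ).
move: (tsum _ a I) (tsum _ a I) (tsum _ b I).
move=> A1 A0 S1 E1 E2 J1 J2 w M0 S0 S2 A2.
have {}S2 := ler_wpM2l C0 S2.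
have CS : C * S1 <= C ^+ 2 * S1 by rewrite ler_wpM2r // expr2 ler_peMl.
have S1C : 0 <= C ^+ 2 * S1 by rewrite mulr_ge0 // sqr_ge0.
have CA : C * A1 <= C ^+ 2 * A1 by rewrite ler_wpM2r // expr2 ler_peMl.
have A1C : A1 <= C * A1 by rewrite ler_peMl.
by lra.
Qed.

End Stopping.

(** * The dyadic system as a measure space *)

Lemma esumZ_le (R : realType) (T : choiceType) (A : set T) (a : T -> \bar R) (c : R) :
  0 <= c -> (forall i, 0 <= a i)%E ->
  (\esum_(i in A) (c%:E * a i) <= c%:E * \esum_(i in A) a i)%E.
Proof.
move=> c0 a0; apply: ge_ereal_sup => _ [X XA <-].
rewrite -ge0_mule_fsumr // lee_wpmul2l ?lee_fin //.
by apply: esum_ge; exists X.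
Qed.

Lemma le_esum_subset (R : realType) (T : choiceType) (A B : set T) (a : T -> \bar R) :
  A `<=` B -> (\esum_(i in A) a i <= \esum_(i in B) a i)%E.
Proof.
move=> AB; apply: ge_ereal_sup => _ [X [finX XA] <-]; apply: esum_ge.
by exists X => //; split=> // x /XA /AB.
Qed.

Section Layers.
Context {R : realType}.
Implicit Types (X : dyadic -> R) (k : int) (n : nat).

Definition generation k : set dyadic := [set I | I.1 = k].
Definition layers k n : set dyadic := [set I | k <= I.1 < k + n%:Z].

Lemma esum_generation_succ X k : (forall I, 0 <= X I) ->
  \esum_(I in generation (k + 1)) (X I)%:E =
  \esum_(I in generation k) (X (child_left I) + X (child_right I))%:E.
Proof.
move=> X0; rewrite (esumID (child_left @` generation k)); last first.
  by move=> I _; rewrite lee_fin.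
have -> : generation (k + 1) `&` child_left @` generation k =
    child_left @` generation k.
  by apply: setIidr => _ [I + <-]; rewrite /generation /= => ->.
have -> : generation (k + 1) `&` ~` (child_left @` generation k) =
    child_right @` generation k.
  apply/seteqP; split=> [I [kI nI]|_ [I kI <-]] /=.
    have [e|e] := child_of_parent I; last first.
      by exists (parent I) => //; rewrite /generation /= kI; lia.
    by case: nI; exists (parent I) => //; rewrite /generation /= kI; lia.
  split; first by rewrite /generation /= kI.
  by move=> [J _]; rewrite /child_left /child_right => -[_]; lia.
rewrite !esum_image.
- by rewrite -esumD // => I _; rewrite lee_fin.
- by move=> I J _ _ /(congr1 parent); rewrite !parent_right.
- by move=> I J _ _ /(congr1 parent); rewrite !parent_left.
Qed.

(** The layers form a forest rooted at generation k; peeling off the roots turns estimates on trees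
    into estimates of unordered sums. *)
Lemma esum_layers X k n : (forall I, 0 <= X I) ->
  \esum_(I in layers k n) (X I)%:E = \esum_(I in generation k) (tsum n X I)%:E.
Proof.
move=> X0; elim: n k => [|n ih] k.
  have -> : layers k 0 = set0 by apply/seteqP; split=> I //; rewrite /layers /=; lia.
  by rewrite esum_set0 esum1.
rewrite (esumID (generation k)); last by move=> I _; rewrite lee_fin.
have -> : layers k n.+1 `&` generation k = generation k.
  by apply: setIidr => I; rewrite /layers /generation /=; lia.
have -> : layers k n.+1 `&` ~` generation k = layers (k + 1) n.
  by apply/seteqP; split=> I; rewrite /layers /generation /=; lia.
rewrite ih esum_generation_succ => [|I]; last exact: tsum_ge0.
rewrite -esumD // => I _; first by rewrite lee_fin.
by rewrite lee_fin addr_ge0 ?tsum_ge0.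
Qed.

Lemma layers_widen k a b : (a <= b)%N -> layers k a `<=` layers k b.
Proof.
by move=> ab I; rewrite /layers /= => /andP[-> Ia] /=; apply: lt_le_trans Ia _; lia.
Qed.

End Layers.

Section DyadicGeometry.
Context {R : realType}.
Implicit Types (I J : dyadic).

Lemma measurable_ditv I : measurable (ditv R I).
Proof. exact: measurable_itv. Qed.

Lemma ditv_children I :
  ditv R I = ditv R (child_left I) `|` ditv R (child_right I) /\
  [disjoint ditv R (child_left I) & ditv R (child_right I)].
Proof.
case: I => k j; rewrite /ditv /child_left /child_right /=.
have -> : (2 : R) ^ (- k) = 2 ^ (- (k + 1)) * 2.
  by rewrite opprD expfzDr // -mulrA mulVf ?mulr1.
have : (0 : R) < 2 ^ (- (k + 1)) by rewrite exprz_gt0.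
move: (2 ^ _) => e e0.
rewrite !intrD !intrM -[(2 : int)%:~R]/(2 : R) -[(1 : int)%:~R]/(1 : R).
split.
  apply/seteqP; split=> x /=; rewrite !in_itv /=.
    move=> /andP[x1 x2]; have [xl|xr] := ltP x (e * (2 * j%:~R + 1)).
      by left; rewrite andbT; apply: le_trans x1; lra.
    by right; rewrite /=; apply: lt_le_trans x2 _; lra.
  case=> /andP[x1 x2]; apply/andP; split.
  - by apply: le_trans x1; lra.
  - by apply: lt_le_trans x2 _; nra.
  - by apply: le_trans x1; nra.
  - by apply: lt_le_trans x2 _; lra.
apply/disj_setPS => x [] /=; rewrite !in_itv /= => /andP[x1 x2] /andP[x3 x4].
by have := le_lt_trans x3 x2; rewrite ltxx.
Qed.

Lemma ditv_generation_disjoint I J : I.1 = J.1 -> ditv R I `&` ditv R J !=set0 -> I = J.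
Proof.
case: I J => k i [_ j] /= <- [x []]; rewrite /ditv /= !in_itv /=.
have : (0 : R) < 2 ^ (- k) by rewrite exprz_gt0.
move: (2 ^ _) => e e0 /andP[i1 i2] /andP[j1 j2]; congr pair.
have := le_lt_trans i1 j2; have := le_lt_trans j1 i2.
by rewrite !ltr_pM2l // !ltr_int; lia.
Qed.

End DyadicGeometry.

Section DyadicAverages.
Context {R : realType}.
Variable mu : {measure set (measurableTypeR R) -> \bar R}.
Hypothesis mu_pos_finite : dyadic_pos_finite mu.
Implicit Types (I J : dyadic) (f g : R -> R).

Lemma dmeasE I : mu (ditv R I) = (dmeas mu I)%:E.
Proof.
have /andP[h0 hoo] := mu_pos_finite I.
by rewrite /dmeas fineK // ge0_fin_numE // ltW.
Qed.

Lemma dmeas_gt0 I : 0 < dmeas mu I.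
Proof. by rewrite -lte_fin -dmeasE; have /andP[] := mu_pos_finite I. Qed.

Lemma dmeas_children I :
  dmeas mu I = dmeas mu (child_left I) + dmeas mu (child_right I).
Proof.
have [e d] := @ditv_children R I.
apply/EFin_inj; rewrite EFinD -!dmeasE e measureU //; try exact: measurable_ditv.
exact/disj_set2P.
Qed.

Lemma average_mul f I :
  dmeas mu I * average mu f I = \int[mu]_(x in ditv R I) f x.
Proof. by rewrite /average mulrA mulfV ?mul1r // gt_eqF // dmeas_gt0. Qed.

Lemma integrable_ditv f I : mu.-integrable setT (EFin \o f) ->
  mu.-integrable (ditv R I) (EFin \o f).
Proof. by apply: integrableS => //; exact: measurable_ditv. Qed.

Lemma average_martingale f : mu.-integrable setT (EFin \o f) ->
  (forall x, 0 <= f x) -> martingale (dmeas mu) (average mu f).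
Proof.
move=> fi f0 I; split.
  rewrite /average mulr_ge0 ?invr_ge0 ?(ltW (dmeas_gt0 _)) //.
  exact: Rintegral_ge0.
have [e d] := @ditv_children R I; rewrite !average_mul e.
rewrite Rintegral_setU //; try exact: measurable_ditv.
by rewrite -e; exact: integrable_ditv.
Qed.

Lemma pairing_indic f I : mu.-integrable setT (EFin \o f) ->
  pairing mu f \1_(ditv R I) = \int[mu]_(x in ditv R I) f x.
Proof.
move=> fi; rewrite /pairing [RHS]Rintegral_mkcond; apply: eq_Rintegral => x _.
by rewrite patchE indicE; case: ifP => _; rewrite ?mulr1 ?mulr0.
Qed.

Lemma integrable_indic f I : mu.-integrable setT (EFin \o f) ->
  mu.-integrable setT (EFin \o (fun x => f x * \1_(ditv R I) x)).
Proof.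
move=> fi; have := integrable_ditv I fi.
move/(integrable_mkcond _ (measurable_ditv I)).
apply: eq_integrable => // x _ /=.
rewrite patchE /= indicE; case: ifP => _; by rewrite ?mulr1 ?mulr0.
Qed.

Lemma haarE I x : haar mu I x =
  Num.sqrt (mcoef mu I) / dmeas mu (child_left I) * \1_(ditv R (child_left I)) x
  - Num.sqrt (mcoef mu I) / dmeas mu (child_right I) * \1_(ditv R (child_right I)) x.
Proof. by rewrite /haar; ring. Qed.

Lemma integrable_haar f I : mu.-integrable setT (EFin \o f) ->
  mu.-integrable setT (EFin \o (fun x => f x * haar mu I x)).
Proof.
move=> fi; set a := Num.sqrt (mcoef mu I) / dmeas mu (child_left I).
set b := Num.sqrt (mcoef mu I) / dmeas mu (child_right I).
have := integrableB measurableT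
  (integrableZl measurableT a (integrable_indic (child_left I) fi))
  (integrableZl measurableT b (integrable_indic (child_right I) fi)).
apply: eq_integrable => // x _ /=.
by rewrite -!EFinM -EFinB haarE -/a -/b; congr (_%:E); ring.
Qed.

Lemma pairing_haar f I : mu.-integrable setT (EFin \o f) ->
  pairing mu f (haar mu I) = Num.sqrt (mcoef mu I) *
    (average mu f (child_left I) - average mu f (child_right I)).
Proof.
move=> fi; set a := Num.sqrt (mcoef mu I) / dmeas mu (child_left I).
set b := Num.sqrt (mcoef mu I) / dmeas mu (child_right I).
transitivity (\int[mu]_x (a * (f x * \1_(ditv R (child_left I)) x)
    - b * (f x * \1_(ditv R (child_right I)) x))).
  by apply: eq_Rintegral => x _; rewrite haarE -/a -/b; ring.
have hi c J : mu.-integrable setT (EFin \o (fun x => c * (f x * \1_(ditv R J) x))).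
  have := integrableZl measurableT c (integrable_indic J fi).
  by apply: eq_integrable => // x _ /=; rewrite -EFinM.
rewrite RintegralB // !RintegralZl //; try exact: integrable_indic.
have := pairing_indic (child_left I) fi; have := pairing_indic (child_right I) fi.
by rewrite /pairing => -> ->; rewrite /average /a /b; ring.
Qed.

End DyadicAverages.

(** * Sparse families and sparse forms *)

Section Sparse.
Context {R : realType}.
Variable mu : {measure set (measurableTypeR R) -> \bar R}.
Hypothesis mu_pos_finite : dyadic_pos_finite mu.
Variables (f g : dyadic -> R) (k : int) (n : nat).
Notation M := (dmeas mu).
Hypothesis f_mart : martingale M f.
Hypothesis g_mart : martingale M g.
Implicit Types (I J : dyadic).
Notation stp := (stop f g k).
Notation sel := (selected f g k).

Definition stopping_family : set dyadic :=
  layers k n.+1 `&` [set I | sel I].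

Lemma ditv_stop I : ditv R I `<=` ditv R (stp I).
Proof.
rewrite /stop; move: (absz _) => d; elim: d I => [|d ih] I x Ix //=.
by case: ifP => // _; apply: (ih (parent I)); exact: ditv_ancestor Ix.
Qed.

(* The intervals of the last generation for which the current stopping interval
   is J: this makes disjointness for distinct J immediate. *)
Definition core J : set (measurableTypeR R) :=
  \bigcup_(I in generation (k + n%:Z) `&` [set I | stp I = J]) ditv R I.

Lemma measurable_core J : measurable (core J).
Proof.
rewrite /core bigcup_mkcond; apply: countable_bigcupT_measurable.
  exact: countableP.
by move=> I; case: ifP => _; [exact: measurable_ditv | exact: measurable0].
Qed.

Lemma trivIset_core : trivIset setT core.
Proof.
move=> J J' _ _ [x [[I [Ik IJ] Ix] [I' [I'k I'J'] I'x]]].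
rewrite -IJ -I'J'; congr (stop f g k).
apply: (@ditv_generation_disjoint R); last by exists x.
by rewrite Ik I'k.
Qed.

Let M_gt0 := dmeas_gt0 mu_pos_finite.
Let M_add := dmeas_children mu_pos_finite.

(** Induction on the number d of generations down to the last one. The subtracted quarter of the
    normalised integrals dominates the measure lost to selected descendants, as in a weak type
    estimate. *)
Lemma measure_core (d : nat) I : I.1 + d%:Z = k + n%:Z -> k <= I.1 ->
  ((M I - (M I * f I / f (stp I) + M I * g I / g (stp I)) / 4)%:E
    <= mu (core (stp I) `&` ditv R I))%E.
Proof.
have h_ge0 h J p : martingale M h -> 0 <= M J * h J / h p.
  move=> hm; rewrite divr_ge0 ?(martingale_ge0 _ hm) // mulr_ge0 ?(martingale_ge0 _ hm) //.
  exact/ltW/M_gt0.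
elim: d I => [|d ih] I dI kI.
  have -> : core (stp I) `&` ditv R I = ditv R I.
    apply: setIidr => x xI; exists I => //; split => //=.
    by rewrite /generation /= -dI addr0.
  rewrite dmeasE // lee_fin.
  by have := h_ge0 f I (stp I) f_mart; have := h_ge0 g I (stp I) g_mart; lra.
set p := stp I; set l := child_left I; set r := child_right I.
have [e /disj_set2P dis] := @ditv_children R I.
rewrite e setIUr measureU //; last first.
- by rewrite setIACA dis setI0.
- by apply: measurableI; [exact: measurable_core | exact: measurable_ditv].
- by apply: measurableI; [exact: measurable_core | exact: measurable_ditv].
have child c : parent c = I ->
    ((M c - (M c * f c / f p + M c * g c / g p) / 4)%:E <= mu (core p `&` ditv R c))%E.
  move=> cI; have c1 : c.1 = I.1 + 1 by rewrite -cI parent_gen; lia.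
  case: (boolP (sel c)) => sc; last first.
    have := ih c; rewrite (stop_child _ _ cI kI) (negbTE sc); apply; lia.
  (* For a selected child the bound is at most 0: one of the two normalised integrals is at least 4
     times its measure. *)
  apply: le_trans (measure_ge0 _ _); rewrite lee_fin.
  have large h : martingale M h -> 4 * h p < h c -> 4 * M c <= M c * h c / h p.
    move=> hm hpc; have h0 : 0 < h p.
      rewrite lt_def (martingale_ge0 _ hm) andbT; apply/eqP => hp0.
      have hI := stop0 M_gt0 hm hp0; rewrite -cI in hI.
      have hc := martingale_child0 M_gt0 hm hI.
      by move: hpc; rewrite hp0 hc mulr0 ltxx.
    rewrite ler_pdivlMr //; have := ltW hpc; have := M_gt0 c; nra.
  move: sc; rewrite (selected_childE _ _ cI kI) => /orP[] /large h.
    by have := h f_mart; have := h_ge0 g c p g_mart; lra.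
  by have := h g_mart; have := h_ge0 f c p f_mart; lra.
apply: le_trans (leeD (child l (parent_left I)) (child r (parent_right I))).
rewrite -EFinD lee_fin (proj2 (f_mart I)) (proj2 (g_mart I)) M_add -/l -/r; lra.
Qed.

Lemma sparse_stopping_family : sparse mu 2^-1 stopping_family.
Proof.
exists core; split; last by move=> J J' _ _; exact: trivIset_core.
move=> J [/andP[kJ Jn] sJ].
have dJ : J.1 + (absz (k + n%:Z - J.1)%R)%:Z = k + n%:Z.
  have d0 : 0 <= k + n%:Z - J.1 by rewrite subr_ge0 -ltzD1 -addrA [n%:Z + 1]addrC -intS.
  by rewrite gez0_abs // addrC subrK.
have pJ : stp J = J := stop_selected sJ.
split; first exact: measurable_core.
  move=> x [I [Ik <-]] Ix.
  exact: ditv_stop Ix.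
have := measure_core dJ kJ; rewrite pJ.
(* At I = J both normalised integrals are at most M J, so a quarter of their sum leaves M J / 2;
   hence the constant 1/2. *)
have le1 h : martingale M h -> M J * h J / h J <= M J.
  move=> hm; have [->|h0] := eqVneq (h J) 0.
    by rewrite invr0 mulr0; exact/ltW/M_gt0.
  by rewrite mulfK.
rewrite dmeasE // -EFinM => h; apply: le_trans (le_trans h _).
  by rewrite lee_fin; have := le1 f f_mart; have := le1 g g_mart; lra.
apply: le_measure; rewrite ?inE.
- by apply: measurableI; [exact: measurable_core | exact: measurable_ditv].
- exact: measurable_core.
- exact: subIsetl.
Qed.

End Sparse.

Section Forms.
Context {R : realType}.
Variable mu : {measure set (measurableTypeR R) -> \bar R}.
Hypothesis mu_pos_finite : dyadic_pos_finite mu.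
Variables (f1 f2 : R -> R) (k : int) (n : nat).
Hypothesis f1_int : mu.-integrable setT (EFin \o f1).
Hypothesis f2_int : mu.-integrable setT (EFin \o f2).
Hypothesis f1_ge0 : forall x, 0 <= f1 x.
Hypothesis f2_ge0 : forall x, 0 <= f2 x.
Implicit Types (I J : dyadic).
Notation M := (dmeas mu).
Notation f := (average mu f1).
Notation g := (average mu f2).
Notation sel := (selected f g k).
Notation S := (stopping_family f g k n.+1).

Let M_gt0 := dmeas_gt0 mu_pos_finite.
Let M_add := dmeas_children mu_pos_finite.
Let f_mart := average_martingale mu_pos_finite f1_int f1_ge0.
Let g_mart := average_martingale mu_pos_finite f2_int f2_ge0.

Lemma mass_le_form_A :
  (\esum_(I in layers k n.+1) (mass M f g k I)%:E <= form_A mu S f1 f2)%E.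
Proof.
rewrite /form_A /stopping_family esum_mkcondr.
apply: le_trans (le_esum_subset _ (@layers_widen k n.+1 n.+2 _)) _ => //.
apply: le_esum => I _; rewrite /mass; case: ifP => [|/negP] sI.
  by move: sI; rewrite inE /= => ->; rewrite mul1r.
suff -> : sel I = false by rewrite mul0r.
by apply/negbTE/negP => h; apply: sI; rewrite inE.
Qed.

(** The family S reaches one generation below the layers that are summed, so that children of
    siblings still qualify. *)
Lemma layers_sibling I : layers k n.+1 I -> [/\ layers k n.+2 (sibling I),
  layers k n.+2 (child_left (sibling I)) & layers k n.+2 (child_right (sibling I))].
Proof. by case: I => a b; rewrite /layers /= => ab; split; lia. Qed.

Lemma inner_le_form_C :
  (\esum_(I in layers k n.+1) ((sel I)%:R * inner M f g k I)%:E
    <= form_C mu S f1 f2)%E.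
Proof.
have f0 I : 0 <= f I by exact: martingale_ge0 f_mart.
have g0 I : 0 <= g I by exact: martingale_ge0 g_mart.
have m0 I : 0 <= mcoef mu I := ltW (mweight_gt0 M_gt0 I).
have t0 I J : (0 <= ((f I * g J + g I * f J) * mcoef mu I)%:E)%E.
  by rewrite lee_fin; apply: mulr_ge0 => //; apply: addr_ge0; exact: mulr_ge0.
rewrite /form_C {1}/stopping_family [leRHS]esum_mkcondr.
apply: le_trans (_ : _ <= \esum_(I in layers k n.+1) _)%E
  (le_esum_subset _ (@layers_widen k n.+1 n.+2 _)) => //.
apply: le_esum => I /layers_sibling[cn ln rn]; case: ifP => [|/negP] sI; last first.
  suff -> : sel I = false by rewrite mul0r.
  by apply/negbTE/negP => h; apply: sI; rewrite inE.
move: sI; rewrite inE /= => ->; rewrite mul1r.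
set c := sibling I; rewrite esum_mkcond.
(* It suffices to keep three terms of the inner sum, at the sibling and its two children, which are
   distinct. *)
apply: esum_ge; exists [set` [:: c; child_left c; child_right c]].
  by split => //; exact: finite_seq.
rewrite -fsbig_seq /=; last first.
  rewrite !inE andbT negb_or -andbA; apply/and3P; split; apply/eqP.
  - by move/(congr1 fst); rewrite /=; lia.
  - by move/(congr1 fst); rewrite /=; lia.
  - by move/(congr1 snd); rewrite /=; lia.
have term J : J \in layers k n.+2 -> ancestor 1 J = parent I \/ ancestor 2 J = parent I ->
    (((sel J)%:R * (f I * g J * mcoef mu I))%:E <=
     if J \in S `&` descendants_le 2 (parent I)
     then ((f I * g J + g I * f J) * mcoef mu I)%:E else 0)%E.
  rewrite inE => Jn Ja; case: (boolP (sel J)) => sJ; last first.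
    by rewrite mul0r; case: ifP.
  rewrite ifT; last first.
    rewrite inE; split => //; case: Ja => Ja; first by exists 1%N.
    by exists 2%N.
  (* The symmetric product g I * f J is dropped. *)
  by rewrite mul1r lee_fin ler_wpM2r // lerDl mulr_ge0.
rewrite !big_cons big_nil addr0.
have tc := term c; have tl := term (child_left c); have tr := term (child_right c).
apply: le_trans (leeD (tc _ _) (leeD (tl _ _) (tr _ _))).
- by rewrite -!EFinD lee_fin /inner -/c /mcoef /mweight; lra.
- by rewrite inE.
- by left; exact: parent_sibling.
- by rewrite inE.
- by right; exact: ancestor2_sibling_left.
- by rewrite inE.
- by right; exact: ancestor2_sibling_right.
Qed.

Lemma esum_block_le (B : dyadic -> R) (C : R) : 0 <= C -> (forall I, 0 <= B I) ->
  (forall I, k <= I.1 -> sel I -> tsum n B I <= C *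
     (tsum n.+1 (mass M f g k) I +
      tsum n.+1 (fun J => (sel J)%:R * inner M f g k J) I)) ->
  (\esum_(I in layers k n) (B I)%:E <=
    C%:E * (form_A mu S f1 f2 + form_C mu S f1 f2))%E.
Proof.
move=> C0 B0 BC; rewrite esum_layers //.
have mass0 I : 0 <= mass M f g k I by exact: mass_ge0.
have inner0 I : 0 <= (sel I)%:R * inner M f g k I.
  by rewrite mulr_ge0 // (inner_ge0 k M_gt0 f_mart g_mart).
apply: (@le_trans _ _ (\esum_(I in generation k) (C%:E *
  ((tsum n.+1 (mass M f g k) I)%:E +
   (tsum n.+1 (fun J => (sel J)%:R * inner M f g k J) I)%:E)))%E).
  apply: le_esum => I /= kI; rewrite -EFinD -EFinM lee_fin.
  (* Every root is its own stopping interval, hence selected. *)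
  by apply: BC; [rewrite kI | rewrite /selected stop_root].
apply: le_trans (esumZ_le _ C0 _) _.
  by move=> I; rewrite -EFinD lee_fin addr_ge0 // tsum_ge0.
rewrite lee_wpmul2l ?lee_fin // esumD; last 2 first.
- by move=> I _; rewrite lee_fin tsum_ge0.
- by move=> I _; rewrite lee_fin tsum_ge0.
rewrite -!esum_layers //.
exact: leeD mass_le_form_A inner_le_form_C.
Qed.

End Forms.

(** * Reduction of Haar shifts to finite sums *)

Section BoundedCompactSupport.
Context {R : realType}.
Variable mu : {measure set (measurableTypeR R) -> \bar R}.
Hypothesis mu_pos_finite : dyadic_pos_finite mu.

(** No dyadic interval has 0 in its interior, so the support is covered by the two intervals from
    -2^n to 0 and from 0 to 2^n. *)
Lemma bounded_compact_support_dyadic (f : R -> R) : bounded_compact_support f ->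
  exists A : set (measurableTypeR R),
    [/\ measurable A, (mu A < +oo)%E & forall x, f x != 0 -> A x].
Proof.
move=> [_ _ /compact_bounded[M [_ /(_ (M + 1))]]].
rewrite ltrDl ltr01 => /(_ isT) bM.
pose n := Num.bound `|M + 1|.
exists (ditv R (- n%:Z, -1) `|` ditv R (- n%:Z, 0)); split.
- by apply: measurableU; exact: measurable_ditv.
- apply: le_lt_trans (measureU2 _ (@measurable_ditv R _) (@measurable_ditv R _)) _.
  apply: lte_add_pinfty.
    by have /andP[] := mu_pos_finite (- n%:Z, -1).
  by have /andP[] := mu_pos_finite (- n%:Z, 0).
move=> x fx; have : `|x| <= M + 1 by apply: bM; exact: subset_closure.
have nM : M + 1 < 2 ^ n%:Z.
  apply: le_lt_trans (ler_norm _) _; apply: lt_le_trans (archi_boundP _) _ => //.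
  by rewrite -exprnP -natrX ler_nat; apply/ltnW/ltn_expl.
move=> /le_lt_trans/(_ nM); rewrite ltr_norml => /andP[x1 x2].
rewrite /ditv /= !in_itv /= opprK addrC subrr add0r.
rewrite mulr0 mulr1 rmorphN mulrN mulr1.
by have [x0|x0] := ltP x 0; [left|right]; rewrite ?x0 ?x1 ?x2 ?(ltW x1).
Qed.

Lemma bounded_compact_support_integrable (f : R -> R) : bounded_compact_support f ->
  mu.-integrable setT (EFin \o f).
Proof.
move=> fs; have [A [mA Aoo fA]] := bounded_compact_support_dyadic fs.
have [mf [M fM] _] := fs.
have : mu.-integrable A (EFin \o f).
  apply: measurable_bounded_integrable => //.
    exact: measurable_funS mf.
  exists M; split; first exact: num_real.
  by move=> y My x _ /=; apply: le_trans (fM x) (ltW My).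
move/(integrable_mkcond _ mA); apply: eq_integrable => // x _ /=.
rewrite patchE; case: ifPn => //; rewrite notin_setE => nA.
by congr (_%:E); apply/esym/eqP/negPn/negP => /fA.
Qed.

Lemma bounded_compact_support_sqr (f : R -> R) : bounded_compact_support f ->
  bounded_compact_support (fun x => f x * f x).
Proof.
move=> [mf [M fM] cf]; split.
- exact: measurable_funM.
- exists (M * M) => x; rewrite normrM; exact: ler_pM.
have -> // : [set x | f x * f x != 0] = [set x | f x != 0].
by apply/seteqP; split=> x /=; rewrite mulf_eq0 orbb.
Qed.

Lemma bounded_compact_support_Lfun2 (f : R -> R) : bounded_compact_support f ->
  f \in Lfun mu 2%:E.
Proof.
move=> fs; have [mf _ _] := fs; rewrite inE; apply/andP; split; rewrite inE //=.
rewrite /finite_norm unlock /Lnorm; apply: poweR_lty.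
have := bounded_compact_support_integrable (bounded_compact_support_sqr fs).
move=> /integrableP[_]; apply: le_lt_trans.
rewrite le_eqVlt; apply/orP; left; apply/eqP; apply: eq_integral => x _ /=.
by rewrite powR_mulrn // normrM expr2.
Qed.

End BoundedCompactSupport.

Section Pairing.
Context {R : realType}.
Variable mu : {measure set (measurableTypeR R) -> \bar R}.
Hypothesis mu_pos_finite : dyadic_pos_finite mu.

(* The integrability is recorded since [pairing] is linear only for integrable
   products. *)
Definition pairs (g h : R -> R) (c : R) :=
  mu.-integrable setT (EFin \o (fun x => h x * g x)) /\ pairing mu h g = c.

Lemma pairsZ g h c a : pairs g h c -> pairs g (fun x => a * h x) (a * c).
Proof.
move=> [hi <-]; split.
  have := integrableZl measurableT a hi; apply: eq_integrable => // x _ /=.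
  by rewrite -EFinM mulrA.
rewrite /pairing -RintegralZl //.
by apply: eq_Rintegral => x _; rewrite mulrA.
Qed.

Lemma pairs_sum g (T : Type) (s : seq T) (h : T -> R -> R) (c : T -> R) :
  (forall i, pairs g (h i) (c i)) ->
  pairs g (fun x => \sum_(i <- s) h i x) (\sum_(i <- s) c i).
Proof.
move=> hc; elim: s => [|i s [ih1 ih2]].
  split; last first.
    rewrite big_nil /pairing; under eq_Rintegral do rewrite big_nil mul0r.
    by rewrite Rintegral_cst // mul0r.
  have := integrable0 mu [set: measurableTypeR R].
  by apply: eq_integrable => // x _ /=; rewrite big_nil mul0r.
have [hi1 hi2] := hc i; split.
  have := integrableD measurableT hi1 ih1; apply: eq_integrable => // x _ /=.
  by rewrite big_cons mulrDl EFinD.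
rewrite big_cons -ih2 -hi2 /pairing -RintegralD //.
by apply: eq_Rintegral => x _; rewrite big_cons mulrDl.
Qed.

(** The list is the right one only for n at most 1, which covers all complexities with s + t at most
    1. *)
Definition descendants_seq (n : nat) (I : dyadic) : seq dyadic :=
  if n is 0%N then [:: I] else [:: child_left I; child_right I].

Lemma descendants_seqE n I : (n <= 1)%N ->
  descendants n I = [set` descendants_seq n I] /\ uniq (descendants_seq n I).
Proof.
case: n => [|[|//]] _; split => //.
- have a0 J : ancestor 0 J = J by case: J => a b; rewrite /ancestor expr0 divz1 subr0.
  by apply/seteqP; split=> J; rewrite /descendants /= inE a0 => /eqP.
- apply/seteqP; split=> J; rewrite /descendants /= !inE.
    move=> JI; have := child_of_parent J; rewrite /parent JI => -[] /eqP -> //.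
    exact: orbT.
  by case/orP => /eqP ->; [exact: parent_left | exact: parent_right].
- by rewrite /= inE andbT; apply/eqP => /(congr1 snd) /=; lia.
Qed.

Lemma haar_block_seqE s t alpha I f x : (s <= 1)%N -> (t <= 1)%N ->
  haar_block mu s t alpha I f x =
  \sum_(J <- descendants_seq s I) \sum_(K <- descendants_seq t I)
    alpha I J K * pairing mu f (haar mu J) * haar mu K x.
Proof.
move=> /(descendants_seqE I)[es us] /(descendants_seqE I)[et ut].
rewrite /haar_block es -fsbig_seq //; apply: eq_bigr => J _.
by rewrite et -fsbig_seq.
Qed.

Lemma measurable_haar_block s t alpha I f : (s <= 1)%N -> (t <= 1)%N ->
  measurable_fun setT (haar_block mu s t alpha I f).
Proof.
move=> s1 t1; apply: (eq_measurable_fun (fun x =>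
  \sum_(J <- descendants_seq s I) \sum_(K <- descendants_seq t I)
    alpha I J K * pairing mu f (haar mu J) * haar mu K x)).
  by move=> x _; rewrite haar_block_seqE.
do 2 (apply: measurable_sum => ?).
have mi J : measurable_fun setT (\1_(ditv R J) : measurableTypeR R -> R).
  by apply: measurable_indic; exact: measurable_ditv.
apply: measurable_funM => //; apply: measurable_funM => //.
by apply: measurable_funB; apply: measurable_funM => //; exact: mi.
Qed.

Lemma pairs_haar g K : mu.-integrable setT (EFin \o g) ->
  pairs g (haar mu K) (pairing mu g (haar mu K)).
Proof.
move=> gi; split.
  have := integrable_haar K gi; apply: eq_integrable => // x _ /=.
  by rewrite mulrC.
by apply: eq_Rintegral => x _; rewrite mulrC.
Qed.

Lemma pairs_haar_block s t alpha I f g : (s <= 1)%N -> (t <= 1)%N ->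
  mu.-integrable setT (EFin \o g) ->
  pairs g (haar_block mu s t alpha I f)
   (\sum_(J <- descendants_seq s I) \sum_(K <- descendants_seq t I)
    alpha I J K * pairing mu f (haar mu J) * pairing mu g (haar mu K)).
Proof.
move=> s1 t1 gi.
have -> : haar_block mu s t alpha I f = fun x =>
  \sum_(J <- descendants_seq s I) \sum_(K <- descendants_seq t I)
    alpha I J K * pairing mu f (haar mu J) * haar mu K x.
  by apply/funext => x; exact: haar_block_seqE.
by do 2 (apply: pairs_sum => ?); apply: pairsZ; exact: pairs_haar.
Qed.

(** One block of the bilinear form, with absolute values and all coefficients replaced by their
    bound 1. *)
Definition block_bound s t f g I : R :=
  \sum_(J <- descendants_seq s I) \sum_(K <- descendants_seq t I)
    haar_coef (dmeas mu) (average mu f) J * haar_coef (dmeas mu) (average mu g) K.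

Lemma haar_coefE f I : mu.-integrable setT (EFin \o f) ->
  haar_coef (dmeas mu) (average mu f) I = `|pairing mu f (haar mu I)|.
Proof. by move=> fi; rewrite pairing_haar // normrM ger0_norm ?sqrtr_ge0. Qed.

Lemma block_bound_ge0 s t f g I : 0 <= block_bound s t f g I.
Proof.
by apply: sumr_ge0 => J _; apply: sumr_ge0 => K _;
  rewrite !mulr_ge0 ?sqrtr_ge0 ?normr_ge0.
Qed.

Lemma norm_block_le s t alpha I f g : (s <= 1)%N -> (t <= 1)%N ->
  (forall I J K, descendants s I J -> descendants t I K -> `|alpha I J K| <= 1) ->
  mu.-integrable setT (EFin \o f) -> mu.-integrable setT (EFin \o g) ->
  `|\sum_(J <- descendants_seq s I) \sum_(K <- descendants_seq t I)
    alpha I J K * pairing mu f (haar mu J) * pairing mu g (haar mu K)|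
  <= block_bound s t f g I.
Proof.
move=> s1 t1 a1 fi gi; have [es _] := descendants_seqE I s1.
have [et _] := descendants_seqE I t1.
apply: le_trans (ler_norm_sum _ _ _) _; rewrite /block_bound.
rewrite [leLHS]big_seq [leRHS]big_seq; apply: ler_sum => J Js.
apply: le_trans (ler_norm_sum _ _ _) _.
rewrite [leLHS]big_seq [leRHS]big_seq; apply: ler_sum => K Kt.
rewrite !haar_coefE // !normrM -mulrA ler_piMl ?mulr_ge0 //.
by apply: a1; [rewrite es | rewrite et].
Qed.

Lemma fset_layers (F : seq dyadic) : exists k n,
  forall I, I \in F -> layers k n I.
Proof.
suff [b bF] : exists b : nat, forall I : dyadic, I \in F -> (absz I.1 <= b)%N.
  exists (- b%:Z), (2 * b).+1 => -[i j] /bF; rewrite /layers /=; lia.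
elim: F => [|J F [b bF]]; first by exists 0%N.
exists (maxn (absz J.1) b) => I; rewrite inE => /orP[/eqP ->|/bF] //.
  by rewrite leq_maxl.
by move=> Ib; rewrite leq_max Ib orbT.
Qed.

(** Hölder's inequality with both exponents equal to 2. *)
Lemma pairing_le_Lnorm f g : f \in Lfun mu 2%:E -> g \in Lfun mu 2%:E ->
  (`|pairing mu f g|%:E <= 'N[mu]_2%:E[EFin \o f] * 'N[mu]_2%:E[EFin \o g])%E.
Proof.
move=> f2 g2; have /Lfun1_integrable fg := Lfun2_mul_Lfun1 f2 g2.
have mf : measurable_fun setT f by move: f2; rewrite inE => /andP[/[!inE]].
have mg : measurable_fun setT g by move: g2; rewrite inE => /andP[/[!inE]].
rewrite EFin_normr_Rintegral //.
apply: le_trans (le_abse_integral _ _ _) _ => //; first by case/integrableP: fg.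
apply: le_trans (@hoelder _ _ _ mu f g 2 2 mf mg _ _ _); rewrite ?Lnorm1 //.
by rewrite [RHS]splitr !div1r.
Qed.

End Pairing.

Section SparseBound.
Context {R : realType}.
Variable mu : {measure set (measurableTypeR R) -> \bar R}.
Hypothesis mu_pos_finite : dyadic_pos_finite mu.

Lemma form_A_sym S (f g : R -> R) : form_A mu S f g = form_A mu S g f.
Proof. by apply: eq_esum => I _; congr (_ * _)%:E; exact: mulrC. Qed.

Lemma form_C_sym S (f g : R -> R) : form_C mu S f g = form_C mu S g f.
Proof. by apply: eq_esum => I _; apply: eq_esum => J _; rewrite [X in X * _]addrC. Qed.

Lemma sparse_block_bound (c : R) (s t : nat) (f1 f2 : R -> R) (k : int) (n : nat) :
  1 <= c ->
  (forall I,
    c^-1 * mcoef mu (parent I) <= mcoef mu I <= c * mcoef mu (parent I)) ->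
  (s + t <= 1)%N ->
  mu.-integrable setT (EFin \o f1) -> mu.-integrable setT (EFin \o f2) ->
  (forall x, 0 <= f1 x) -> (forall x, 0 <= f2 x) ->
  exists S, sparse mu 2^-1 S /\
    (\esum_(I in layers k n) (block_bound mu s t f1 f2 I)%:E <=
      (100 * c ^+ 2)%:E * (form_A mu S f1 f2 + form_C mu S f1 f2))%E.
Proof.
move=> c1 bal; have c0 : 0 < c by exact: lt_le_trans c1.
have {}bal I : mcoef mu (parent I) <= c * mcoef mu I /\
    mcoef mu I <= c * mcoef mu (parent I).
  by have /andP[h1 h2] := bal I; split=> //; rewrite -ler_pdivrMl.
have C0 : 0 <= 100 * c ^+ 2 by rewrite mulr_ge0 ?sqr_ge0.
have M0 := dmeas_gt0 mu_pos_finite; have MD := dmeas_children mu_pos_finite.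
have key s' t' (h1 h2 : R -> R) : (s' == 0)%N && (t' <= 1)%N ->
    mu.-integrable setT (EFin \o h1) -> mu.-integrable setT (EFin \o h2) ->
    (forall x, 0 <= h1 x) -> (forall x, 0 <= h2 x) ->
    exists S, sparse mu 2^-1 S /\
    (\esum_(I in layers k n) (block_bound mu s' t' h1 h2 I)%:E <=
      (100 * c ^+ 2)%:E * (form_A mu S h1 h2 + form_C mu S h1 h2))%E.
  move=> /andP[/eqP -> t1] h1i h2i h10 h20.
  have m1 := average_martingale mu_pos_finite h1i h10.
  have m2 := average_martingale mu_pos_finite h2i h20.
  exists (stopping_family (average mu h1) (average mu h2) k n.+1); split.
    exact: sparse_stopping_family.
  apply: esum_block_le => //; first exact: block_bound_ge0.
  move=> I kI sI; case: t' t1 => [|[|//]] _.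
    have -> : block_bound mu 0 0 h1 h2 = fun J =>
        haar_coef (dmeas mu) (average mu h1) J * haar_coef (dmeas mu) (average mu h2) J.
      by apply/funext => J; rewrite /block_bound /= !big_cons !big_nil !addr0.
    exact: tsum_block00.
  have -> : block_bound mu 0 1 h1 h2 = fun J =>
      haar_coef (dmeas mu) (average mu h1) J *
        (haar_coef (dmeas mu) (average mu h2) (child_left J) +
         haar_coef (dmeas mu) (average mu h2) (child_right J)).
    by apply/funext => J; rewrite /block_bound /= !big_cons !big_nil !addr0 mulrDr.
  exact: tsum_block01.
case: s t => [|[|s]] [|[|t]] // _ f1i f2i f10 f20; try exact: key.
(* Complexity (1, 0) is the transpose of (0, 1): exchange the two functions, both forms being
   symmetric in them. *)
have [S [spS h]] := key 0%N 1%N f2 f1 isT f2i f1i f20 f10.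
exists S; split; first exact: spS.
rewrite form_A_sym form_C_sym.
apply: le_trans _ h; apply: le_esum => I _; rewrite lee_fin.
rewrite /block_bound /= !big_cons !big_nil !addr0.
by rewrite [X in X + _]mulrC [X in _ + X <= _]mulrC.
Qed.

(* F depends on f1 and f2, which is harmless as the sparse family does too. *)
Lemma haar_shift_finite (s t : nat) (T : (R -> R) -> R -> R) (f1 f2 : R -> R) :
  (s + t <= 1)%N -> haar_shift mu s t T ->
  mu.-integrable setT (EFin \o f1) -> mu.-integrable setT (EFin \o f2) ->
  f1 \in Lfun mu 2%:E -> f2 \in Lfun mu 2%:E ->
  pairing mu (T f1) f2 != 0 ->
  exists F : {fset dyadic},
    `|pairing mu (T f1) f2| <= 2 * \sum_(I <- F) block_bound mu s t f1 f2 I.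
Proof.
move=> st [alpha [a1 /(_ f1) hT]] f1i f2i f1L f2L P0.
have s1 : (s <= 1)%N by lia. have t1 : (t <= 1)%N by lia.
have [TL {}hT] := hT f1L.
set P := pairing mu (T f1) f2 in P0 *.
have Pgt0 : 0 < `|P| by rewrite normr_gt0.
have N2fin : ('N[mu]_2%:E[EFin \o f2])%E \is a fin_num.
  rewrite ge0_fin_numE ?Lnorm_ge0 //.
  by move: f2L; rewrite inE => /andP[_ /[!inE]].
pose N2 := fine ('N[mu]_2%:E[EFin \o f2])%E.
have N20 : 0 <= N2 by rewrite fine_ge0 // Lnorm_ge0.
(* With this e the remainder pairs with f2 to at most half of |P| and can be absorbed, at the cost
   of the factor 2. The 1 avoids division by 0, and P must be nonzero for e to be positive. *)
pose e := `|P| / (2 * (N2 + 1)).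
have e0 : 0 < e by rewrite divr_gt0 // mulr_gt0 // ltr_wpDl.
have [F hF] := hT e e0; exists F.
have {hF} := hF F (fsubset_refl F).
pose r x := T f1 x - \sum_(I <- F) haar_block mu s t alpha I f1 x.
rewrite -[X in ('N[_]__[X])%E]/(EFin \o r) => hr.
pose B x := \sum_(I <- F) haar_block mu s t alpha I f1 x.
have [Bi BP] := pairs_sum F (fun I => pairs_haar_block alpha I f1 s1 t1 f2i).
rewrite -/B in Bi BP.
have Ti : mu.-integrable setT (EFin \o (fun x => T f1 x * f2 x)).
  exact/Lfun1_integrable/Lfun2_mul_Lfun1.
have PE : P = pairing mu r f2 + pairing mu B f2.
  rewrite /pairing -RintegralD //; last first.
    have := integrableB measurableT Ti Bi; apply: eq_integrable => // x _ /=.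
    by rewrite -EFinB /r mulrBl.
  by apply: eq_Rintegral => x _; rewrite /r /B mulrBl subrK.
have rL : r \in Lfun mu 2%:E.
  have mr : measurable_fun setT r.
    apply: measurable_funB; first by move: TL; rewrite inE => /andP[/[!inE]].
    by apply: measurable_sum => I; exact: measurable_haar_block.
  rewrite inE; apply/andP; split; rewrite inE //=.
  by apply: le_lt_trans hr _; exact: ltry.
have rP : `|pairing mu r f2| <= `|P| / 2.
  rewrite -lee_fin; apply: le_trans (pairing_le_Lnorm rL f2L) _.
  rewrite -[X in (_ * X)%E](fineK N2fin) -/N2.
  apply: (@le_trans _ _ (e%:E * N2%:E)%E).
    by rewrite lee_wpmul2r // lee_fin.
  have N21 : 0 < N2 + 1 by rewrite ltr_wpDl.
  have eN : e * N2 = `|P| / 2 * (N2 / (N2 + 1)).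
    by rewrite /e; field; rewrite gt_eqF.
  by rewrite -EFinM lee_fin eN ler_piMr ?divr_ge0 // ler_pdivrMr // mul1r lerDl.
have BL : `|pairing mu B f2| <= \sum_(I <- F) block_bound mu s t f1 f2 I.
  rewrite BP; apply: le_trans (ler_norm_sum _ _ _) _.
  by apply: ler_sum => I _; exact: norm_block_le.
have := ler_normD (pairing mu r f2) (pairing mu B f2); rewrite -PE; lra.
Qed.

End SparseBound.

(** * Assembly of the sparse bound *)

Unset Implicit Arguments.

Theorem theorem1 (R : realType)
    (mu : {measure set (measurableTypeR R) -> \bar R})
    (mu_pos_finite : dyadic_pos_finite mu) (mu_balanced : balanced mu) :
  exists eta C : R, [/\ 0 < eta < 1, 0 < C &
    forall (s t : nat), (s + t <= 1)%N ->
    forall T : (R -> R) -> (R -> R), haar_shift mu s t T ->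
    forall f1 f2 : R -> R,
      bounded_compact_support f1 -> bounded_compact_support f2 ->
      (forall x, 0 <= f1 x) -> (forall x, 0 <= f2 x) ->
      exists S : set (int * int), sparse mu eta S /\
        (`|pairing mu (T f1) f2|%:E <=
           C%:E * (form_A mu S f1 f2 + form_C mu S f1 f2))%E].
Proof.
have [_ [c [c1 bal]]] := mu_balanced.
have c0 : 0 < c by exact: lt_le_trans c1.
have C0 : 0 < 100 * c ^+ 2 by rewrite mulr_gt0 ?exprn_gt0.
(* The factor 2 comes from [haar_shift_finite], the rest from [sparse_block_bound]. *)
exists 2^-1, (2 * (100 * c ^+ 2)); split; [lra | exact: mulr_gt0 |].
move=> s t st T hT f1 f2 f1s f2s f10 f20.
have f1i := bounded_compact_support_integrable mu_pos_finite f1s.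
have f2i := bounded_compact_support_integrable mu_pos_finite f2s.
have f1L := bounded_compact_support_Lfun2 mu_pos_finite f1s.
have f2L := bounded_compact_support_Lfun2 mu_pos_finite f2s.
have [P0|P0] := eqVneq (pairing mu (T f1) f2) 0.
  (* A vanishing pairing is bounded by the forms of the empty family. *)
  exists set0; split; first by exists (fun _ => set0); split => // I [].
  by rewrite P0 normr0 /form_A /form_C !esum_set0 adde0 mule0.
have [F hF] := haar_shift_finite st hT f1i f2i f1L f2L P0.
have [k [n Fkn]] := fset_layers F.
have [S [spS hS]] :=
  sparse_block_bound mu_pos_finite k n c1 bal st f1i f2i f10 f20.
exists S; split=> //; rewrite EFinM -muleA.
apply: (@le_trans _ _ (2%:E * (\sum_(I <- F) block_bound mu s t f1 f2 I)%:E)%E).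
  by rewrite -EFinM lee_fin.
rewrite lee_wpmul2l ?lee_fin //; apply: le_trans hS.
(* F is among the finite subsets of the layers over which the unordered sum is a supremum. *)
apply: esum_ge; exists [set` F].
  by split; [exact: finite_fset | move=> I; exact: Fkn].
by rewrite -fsbig_seq ?fset_uniq // sumEFin.
Qed.
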